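(* If $D_1$ and $D_2$ are strong shift equivalent UDAF digraphs, then the objects $(\operatorname{Route}(D_1),D_1)$ and $(\operatorname{Route}(D_2),D_2)$ are isomorphic in the category UDAFG$'$.
   Context: For a finite digraph $D$, $(X_D,\sigma_D)$ is the two-sided subshift of finite type where $X_D$ is the space of all bi-infinite walks in $D$ and $\sigma_D$ is the shift. Finite digraphs $D_1,D_2$ are strong shift equivalent if $(X_{D_1},\sigma_{D_1})$ and $(X_{D_2},\sigma_{D_2})$ are topologically conjugate (equivalently, $(X_{D_1},\sigma_{D_1}^n)$ and $(X_{D_2},\sigma_{D_2}^n)$ are conjugate for all $n\ge1$). Maps are written on the right of their arguments, and $p\circ q$ means first $p$, then $q$. A digraph $D=(V_D,E_D,s_D,t_D)$ consists of a vertex set, an edge set and functions $s_D,t_D:E_D\to V_D$; $e$ is an edge from $(e)s_D$ to $(e)t_D$. A digraph homomorphism $\phi:D_1\to D_2$ is a pair $(\phi_V,\phi_E)$ with $\phi_V:V_{D_1}\to V_{D_2}$, $\phi_E:E_{D_1}\to E_{D_2}$, $\phi_E s_{D_2}=s_{D_1}\phi_V$ and $\phi_E t_{D_2}=t_{D_1}\phi_V$; $\operatorname{Hom}(D_1,D_2)$ is the set of these. For $n\le m$ in $\mathbb Z\cup\{\pm\infty\}$, $\mathbb Z_{[n,m]}$ is the digraph with vertices $\{i\in\mathbb Z:n\le i\le m\}$ and one edge $(i,i+1)$ from $i$ to $i+1$ whenever $n\le i<i+1\le m$. $\operatorname{Walks}(D)$ is the category with object set $V_D$ whose morphisms are the finite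 walks, i.e. elements of $\bigcup_{0\le n<\infty}\operatorname{Hom}(\mathbb Z_{[0,n]},D)$ (an element $p$ of $\operatorname{Hom}(\mathbb Z_{[0,n]},D)$ has length $\|p\|=n$ and goes from $(0)p_V$ to $(n)p_V$), composed by concatenation. It is also regarded as a digraph (objects as vertices, morphisms as edges), and $D$ is identified with the subdigraph of walks of length $1$. A homomorphism $\phi:D_1\to\operatorname{Walks}(D_2)$ extends uniquely to a functor $\widetilde\phi:\operatorname{Walks}(D_1)\to\operatorname{Walks}(D_2)$. A generalised bi-infinite walk in $D$ is a homomorphism $w:\mathbb Z_{[-\infty,\infty]}\to\operatorname{Walks}(D)$; it is degenerate if $\|(n,n+1)w_E\|=0$ for all sufficiently large $n$, or for all sufficiently small $n$. A flattening of a non-degenerate $w$ is a $w_0\in\operatorname{Hom}(\mathbb Z_{[-\infty,\infty]},D)$ for which there is $f:\mathbb Z\to\mathbb Z$ such that for all $z\in\mathbb Z$ and $0\le j<\|(z,z+1)w_E\|$: $(z+1)f=(z)f+\|(z,z+1)w_E\|$ and $((z)f+j,(z)f+j+1)(w_0)_E=(j,j+1)((z,z+1)w_E)_E$ (the first equality being required for all $z$). Two non-degenerate generalised bi-infinite walks are equivalent if they have the same set of flattenings; the classes $[w]$ are called routes and $\operatorname{Route}(D)$ is the set of routes of non-degenerate generalised bi-infinite walks in $D$. For finite $D_1,D_2$, a homomorphism $\phi:D_1\to\operatorname{Walks}(D_2)$ is degenerate if $p\circ\widetilde\phi$ is degenerate for some non-degenerate generalised bi-infinite walk $p$ in $D_1$.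 If $\phi$ is non-degenerate, $\phi_*:\operatorname{Route}(D_1)\to\operatorname{Route}(D_2)$ is $[p]\mapsto[p\circ\widetilde\phi]$. A UDAF digraph is a finite digraph $D$ such that for every $v\in V_D$ the number of $h\in\operatorname{Hom}(\mathbb Z_{[0,\infty]},D)$ with $(0)h_V=v$ is not equal to $1$, and the number of $h\in\operatorname{Hom}(\mathbb Z_{[-\infty,0]},D)$ with $(0)h_V=v$ is not equal to $1$. A UDAF folding is a (non-degenerate) homomorphism $\phi:D_1\to\operatorname{Walks}(D_2)$ such that $\phi_*$ is a bijection (homomorphisms $D_1\to D_2$ are included via $D_2\subseteq\operatorname{Walks}(D_2)$). UDAFG is the smallest category whose objects are the pairs $(\operatorname{Route}(D),D)$ with $D$ a UDAF digraph, in which every $\phi_*$ (for $\phi:D_1\to\operatorname{Walks}(D_2)$ a UDAF folding of UDAF digraphs) is a morphism $(\operatorname{Route}(D_1),D_1)\to(\operatorname{Route}(D_2),D_2)$, and which is closed under composition and inversion of bijections. A UDAF folding $f:D_1\to\operatorname{Walks}(D_2)$ between UDAF digraphs is elementary if one of the following holds. (1) $f$ is a homomorphism embedding $D_1$ into $D_2$ such that $D_2$ consists of the image of $f$ and one other vertex with no edges connected to it. (2) There are a non-loop edge $e\in E_{D_2}$ and a subdigraph $S=(V_{D_1},E_S)$ of $D_1$ such that $f\restriction_S$ is an isomorphism from $S$ to $(V_{D_2},E_{D_2}\setminus\{e\})$, and $f_E\restriction_{E_{D_1}\setminus E_S}$ is a bijection onto $\{p\in\operatorname{Hom}(\mathbb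 Z_{[0,2]},D_2):(0,1)p_E=e\}$. (3) The same as (2) but with the last set replaced by $\{p\in\operatorname{Hom}(\mathbb Z_{[0,2]},D_2):(1,2)p_E=e\}$. UDAFG$'$ is the subcategory of UDAFG (with the same objects) generated by the maps $\phi_*$ and $(\phi_* )^{-1}$ for $\phi$ an elementary UDAF folding between UDAF digraphs. *)

(* Defs.v *)
From HB Require Import structures.
From mathcomp Require Import all_boot all_order all_algebra.
From mathcomp Require Import all_classical.
From mathcomp Require Import topology.

Set Implicit Arguments.
Unset Strict Implicit.
Unset Printing Implicit Defensive.

Import Order.TTheory GRing.Theory Num.Theory.

Local Open Scope classical_set_scope.
Local Open Scope ring_scope.

Record digraph := Digraph {
  dV : Type;
  dE : Type;
  dsrc : dE -> dV;
  dtgt : dE -> dV }.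

Record finDigraph := FinDigraph {
  fV : finType;
  fE : finType;
  fsrc : fE -> fV;
  ftgt : fE -> fV }.

Coercion digraph_of (D : finDigraph) : digraph :=
  Digraph (@fsrc D) (@ftgt D).

Record hom (D1 D2 : digraph) := Hom {
  hV : dV D1 -> dV D2;
  hE : dE D1 -> dE D2;
  hsrc : forall e, dsrc (hE e) = hV (dsrc e);
  htgt : forall e, dtgt (hE e) = hV (dtgt e) }.

HB.instance Definition _ (D1 D2 : digraph) := gen_eqMixin (hom D1 D2).
HB.instance Definition _ (D1 D2 : digraph) := gen_choiceMixin (hom D1 D2).

Lemma homP (D1 D2 : digraph) (p q : hom D1 D2) :
  (forall v, hV p v = hV q v) -> (forall e, hE p e = hE q e) -> p = q.
Proof.
case: p q => [pv pe ps pt] [qv qe qs qt] /= /funext eqv /funext eqe.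
by subst qv qe; congr Hom; exact: Prop_irrelevance.
Qed.

Definition hom_id (D : digraph) : hom D D :=
  @Hom D D id id (fun=> erefl) (fun=> erefl).

(* Diagrammatic order: [p] is applied first. *)
Definition hom_comp (D1 D2 D3 : digraph) (p : hom D1 D2) (q : hom D2 D3) :
    hom D1 D3 :=
  @Hom D1 D3 (fun v => hV q (hV p v)) (fun e => hE q (hE p e))
    (fun e => etrans (hsrc q (hE p e)) (congr1 (hV q) (hsrc p e)))
    (fun e => etrans (htgt q (hE p e)) (congr1 (hV q) (htgt p e))).

(* The bounds n <= m in Z u {-oo, +oo} are given as an interval [I] of
   integers; the edge (i, i+1) is represented by its source i. *)
Definition Zvertex (I : interval int) := {i : int | i \in I}.
Definition Zedge (I : interval int) := {i : int | (i \in I) && (i + 1 \in I)}.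

Definition Zsrc (I : interval int) (e : Zedge I) : Zvertex I :=
  exist _ (sval e) (proj1 (andP (svalP e))).
Definition Ztgt (I : interval int) (e : Zedge I) : Zvertex I :=
  exist _ (sval e + 1) (proj2 (andP (svalP e))).

Definition Zint (I : interval int) : digraph := Digraph (@Zsrc I) (@Ztgt I).

Notation Zline := (Zint `]-oo, +oo[).

Definition zv (i : int) : dV Zline := exist _ i isT.
Definition ze (i : int) : dE Zline := exist _ i isT.

Definition biwalk (D : digraph) := hom Zline D.

Lemma zsucc_src (e : dE Zline) :
  dsrc (ze (sval e + 1)) = zv (sval (dsrc e) + 1).
Proof. exact/val_inj. Qed.

Lemma zsucc_tgt (e : dE Zline) :
  dtgt (ze (sval e + 1)) = zv (sval (dtgt e) + 1).
Proof. exact/val_inj. Qed.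

Definition zsucc : hom Zline Zline :=
  @Hom Zline Zline (fun v => zv (sval v + 1)) (fun e => ze (sval e + 1))
    zsucc_src zsucc_tgt.

Definition shift (D : digraph) (x : biwalk D) : biwalk D := hom_comp zsucc x.

(* Pointwise convergence of vertices and edges, both discrete. *)
Definition coords (D : finDigraph) (x : biwalk D) :
    {ptws int -> discrete_topology (fV D)} *
    {ptws int -> discrete_topology (fE D)} :=
  (fun i => hV x (zv i), fun i => hE x (ze i)).

Definition shift_space (D : finDigraph) : topologicalType :=
  initial_topology (@coords D).

Definition conjugate (X Y : topologicalType) (S : X -> X) (T : Y -> Y) : Prop :=
  exists (h : X -> Y) (k : Y -> X),
    [/\ continuous h, continuous k, cancel h k, cancel k h &
        forall x, h (S x) = T (h x)].

Definition strong_shift_equivalent (D1 D2 : finDigraph) : Prop :=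
  @conjugate (shift_space D1) (shift_space D2) (@shift D1) (@shift D2).

Fixpoint is_walk (D : finDigraph) (v : fV D) (s : seq (fE D)) : bool :=
  if s is e :: s' then (fsrc e == v) && is_walk (ftgt e) s' else true.

(* A finite walk is stored as its first vertex and its sequence of edges; see
   [walk_of_homP] for the correspondence with homomorphisms from Z_[0,n]. *)
Definition walk (D : finDigraph) := {p : fV D * seq (fE D) | is_walk p.1 p.2}.

Definition wstart (D : finDigraph) (p : walk D) : fV D := (sval p).1.
Definition wedges (D : finDigraph) (p : walk D) : seq (fE D) := (sval p).2.
Definition wend (D : finDigraph) (p : walk D) : fV D :=
  last (wstart p) (map (@ftgt D) (wedges p)).
Definition wlen (D : finDigraph) (p : walk D) : nat := size (wedges p).

Definition Walks (D : finDigraph) : digraph := Digraph (@wstart D) (@wend D).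

Lemma walk_inj (D : finDigraph) (p q : walk D) :
  wstart p = wstart q -> wedges p = wedges q -> p = q.
Proof.
case: p q => [[a s] ps] [[b t] pt]; rewrite /wstart /wedges /= => ab st.
by apply: val_inj; rewrite /= ab st.
Qed.

Lemma is_walk_cat (D : finDigraph) (v : fV D) (s1 s2 : seq (fE D)) :
  is_walk v (s1 ++ s2) =
  is_walk v s1 && is_walk (last v (map (@ftgt D) s1)) s2.
Proof. by elim: s1 v => //= e s1 IH v; rewrite IH andbA. Qed.

Definition walk_id (D : finDigraph) (v : fV D) : walk D :=
  exist (fun p => is_walk p.1 p.2) (v, [::]) isT.

Lemma walk_edge_subproof (D : finDigraph) (e : fE D) :
  is_walk (fsrc e) [:: e].
Proof. by rewrite /= eqxx. Qed.

Definition walk_edge (D : finDigraph) (e : fE D) : walk D :=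
  exist (fun p => is_walk p.1 p.2) (fsrc e, [:: e]) (walk_edge_subproof e).

Lemma walk_cat_subproof (D : finDigraph) (p q : walk D) :
  wend p = wstart q -> is_walk (wstart p) (wedges p ++ wedges q).
Proof.
by move=> pq; rewrite is_walk_cat -/(wend p) pq (svalP p) (svalP q).
Qed.

Definition walk_cat (D : finDigraph) (p q : walk D) (pq : wend p = wstart q) :
    walk D :=
  exist (fun p => is_walk p.1 p.2) (wstart p, wedges p ++ wedges q)
    (walk_cat_subproof pq).

(* D as a subdigraph of Walks(D). *)
Definition walk_incl (D : finDigraph) : hom D (Walks D) :=
  @Hom D (Walks D) id (@walk_edge D) (fun=> erefl) (fun=> erefl).

(* [p] has, for each i, the i-th edge of [h]. *)
Definition represents (D : finDigraph) (n : nat)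
    (h : hom (Zint `[0, n%:Z]) D) (p : walk D) : Prop :=
  [/\ wlen p = n,
      forall v : dV (Zint `[0, n%:Z]), sval v = 0 -> wstart p = hV h v &
      forall (e : dE (Zint `[0, n%:Z])) (i : nat), sval e = i%:Z ->
        onth (wedges p) i = Some (hE h e)].

Lemma is_walkP (D : finDigraph) (v : fV D) (s : seq (fE D)) :
  is_walk v s <->
  forall i e, onth s i = Some e ->
    onth (v :: map (@ftgt D) s) i = Some (fsrc e).
Proof.
elim: s v => [|e s IH] v /=; first by split=> // _ i e; rewrite onth0n.
split=> [/andP[/eqP ev /IH w] [|i] d /=|w].
- by case=> <-; rewrite ev.
- exact: w.
- have [->] := w 0%N e erefl; rewrite eqxx; apply/IH => i d.
  exact: (w i.+1 d).
Qed.

Lemma Zvertex_nat (n : nat) (v : dV (Zint `[0, n%:Z])) :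
  exists2 i : nat, (i <= n)%N & sval v = i%:Z.
Proof.
have := svalP v; rewrite in_itv /=; case: (sval v) => [i|i] //= lein.
by exists i.
Qed.

Lemma Zedge_nat (n : nat) (e : dE (Zint `[0, n%:Z])) :
  exists2 i : nat, (i < n)%N & sval e = i%:Z.
Proof.
have [i _ ei] := Zvertex_nat (dsrc e); have [j jn ej] := Zvertex_nat (dtgt e).
exists i => //; move: ei ej => /= -> /eqP.
by rewrite -PoszD eqz_nat addn1 => /eqP ->.
Qed.

Lemma Zvertex_in (n i : nat) : (i <= n)%N -> i%:Z \in `[0, n%:Z].
Proof. by rewrite in_itv /= lez_nat. Qed.

Lemma Zedge_in (n i : nat) : (i < n)%N ->
  (i%:Z \in `[0, n%:Z]) && (i%:Z + 1 \in `[0, n%:Z]).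
Proof. by move=> lt_in; rewrite -PoszD addn1 !Zvertex_in // ltnW. Qed.

Lemma walk_of_homP (D : finDigraph) (n : nat) :
  (forall h : hom (Zint `[0, n%:Z]) D, exists! p, represents h p) /\
  (forall p : walk D, wlen p = n ->
    exists! h : hom (Zint `[0, n%:Z]) D, represents h p).
Proof.
split=> [h|p pn].
- pose ed (i : 'I_n) : dE (Zint `[0, n%:Z]) :=
    exist _ (i : nat)%:Z (Zedge_in (ltn_ord i)).
  pose v0 : dV (Zint `[0, n%:Z]) := exist _ 0%N%:Z (Zvertex_in (leq0n n)).
  pose s : seq (fE D) := [seq (hE h (ed i) : fE D) | i <- enum 'I_n].
  have sE (e : dE (Zint `[0, n%:Z])) (i : nat) :
      sval e = i%:Z -> onth s i = Some (hE h e).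
    move=> ei; have [j jn] := Zedge_nat e; rewrite ei => /eqP.
    rewrite eqz_nat => /eqP ij; rewrite -ij in jn.
    rewrite onthE /s -map_comp (nth_map (Ordinal jn)) ?size_enum_ord //=.
    congr (Some (hE h _)); apply: val_inj => /=.
    by rewrite nth_enum_ord // -ei.
  have ws : is_walk (hV h v0 : fV D) s.
    apply/is_walkP => i e ie.
    have ltin : (i < n)%N.
      by rewrite -[n](size_enum_ord n) -(size_map (fun i => hE h (ed i) : fE D))
        -onthTE -/s ie.
    have := ie; rewrite (sE (ed (Ordinal ltin)) i erefl) => -[<-].
    case: i ltin {ie} => [|i] ltin /=.
      congr Some; have /= -> := hsrc h (ed (Ordinal ltin)).
      by congr (hV h _); exact: val_inj.
    rewrite onth_map (sE (ed (Ordinal (ltnW ltin))) i erefl) /=; congr Some.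
    have /= -> := htgt h (ed (Ordinal (ltnW ltin))).
    have /= -> := hsrc h (ed (Ordinal ltin)).
    by congr (hV h _); apply: val_inj; rewrite /= -PoszD addn1.
  exists (exist _ (hV h v0 : fV D, s) ws); split.
    split=> [|v v00|//]; first by rewrite /wlen /wedges /= size_map size_enum_ord.
    by rewrite /wstart /=; congr (hV h _); exact: val_inj.
  move=> q [qn qv qe]; apply: walk_inj; first by rewrite (qv v0).
  apply: eq_from_onth => i /=.
  have [ltin|lein] := ltnP i n.
    by rewrite (sE (ed (Ordinal ltin)) i erefl) (qe (ed (Ordinal ltin)) i).
  rewrite [RHS]onth_default; last by rewrite -/(wlen q) qn.
  by rewrite onth_default // /wedges /= size_map size_enum_ord.
- have exE (e : dE (Zint `[0, n%:Z])) :
      exists x, onth (wedges p) `|sval e|%N = Some x.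
    have [i ltin ->] := Zedge_nat e.
    have : onth (wedges p) i by rewrite onthTE -/(wlen p) pn.
    by rewrite absz_nat; case: onth => // x _; exists x.
  have exV (v : dV (Zint `[0, n%:Z])) :
      exists x, onth (wstart p :: map (@ftgt D) (wedges p)) `|sval v|%N = Some x.
    have [i lein ->] := Zvertex_nat v.
    have : onth (wstart p :: map (@ftgt D) (wedges p)) i.
      by rewrite onthTE /= size_map -/(wlen p) pn.
    by rewrite absz_nat; case: onth => // x _; exists x.
  pose fv v : dV D := sval (cid (exV v)).
  pose fe e : dE D := sval (cid (exE e)).
  have fvE v : onth (wstart p :: map (@ftgt D) (wedges p)) `|sval v|%N
    = Some (fv v) := svalP (cid (exV v)).
  have feE e : onth (wedges p) `|sval e|%N = Some (fe e) := svalP (cid (exE e)).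
  have hs e : dsrc (fe e) = fv (dsrc e).
    have /is_walkP/(_ _ _ (feE e)) := svalP p.
    by have := fvE (dsrc e); rewrite /= => -> [->].
  have ht e : dtgt (fe e) = fv (dtgt e).
    have [i ltin ei] := Zedge_nat e.
    have := fvE (dtgt e); rewrite /= ei -PoszD addn1 absz_nat /= onth_map.
    by have := feE e; rewrite ei absz_nat => -> [<-].
  exists (@Hom (Zint `[0, n%:Z]) D fv fe hs ht); split.
    split=> // [v v0|e i ei].
      by have := fvE v; rewrite v0 /= => -[].
    by have := feE e; rewrite ei absz_nat.
  move=> h [_ hv he]; apply: homP => [v|e] /=.
    have := fvE v; have [[|i] lein vi] := Zvertex_nat v; rewrite vi absz_nat /=.
      by case=> <-; exact: hv.
    have := he (exist _ i%:Z (Zedge_in lein)) i erefl.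
    rewrite onth_map => -> [<-]; have /= -> := htgt h (exist _ i%:Z (Zedge_in lein)).
    by congr (hV h _); apply: val_inj; rewrite /= vi -PoszD addn1.
  have [i ltin ei] := Zedge_nat e.
  have := feE e; rewrite ei absz_nat.
  by rewrite (he e i ei) => -[].
Qed.

Definition ext_edges (D1 D2 : finDigraph) (phi : hom D1 (Walks D2))
    (s : seq (fE D1)) : seq (fE D2) :=
  flatten [seq wedges (hE phi e) | e <- s].

Lemma ext_walk_subproof (D1 D2 : finDigraph) (phi : hom D1 (Walks D2))
    (v : fV D1) (s : seq (fE D1)) : is_walk v s ->
  is_walk (hV phi v) (ext_edges phi s) /\
  last (hV phi v) (map (@ftgt D2) (ext_edges phi s)) =
  hV phi (last v (map (@ftgt D1) s)).
Proof.
elim: s v => [//|e s IH] v /= /andP[/eqP <- /IH[w l]].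
have es : wstart (hE phi e) = hV phi (fsrc e) := hsrc phi e.
have et : wend (hE phi e) = hV phi (ftgt e) := htgt phi e.
rewrite /ext_edges /= is_walk_cat map_cat last_cat -es -/(wend _) et.
by rewrite (svalP (hE phi e)) -/(ext_edges _ _) w l.
Qed.

Definition ext_walk (D1 D2 : finDigraph) (phi : hom D1 (Walks D2))
    (p : walk D1) : walk D2 :=
  exist (fun p => is_walk p.1 p.2)
    (hV phi (wstart p), ext_edges phi (wedges p))
    (proj1 (ext_walk_subproof phi (svalP p))).

Definition ext (D1 D2 : finDigraph) (phi : hom D1 (Walks D2)) :
    hom (Walks D1) (Walks D2) :=
  @Hom (Walks D1) (Walks D2) (hV phi) (ext_walk phi)
    (fun=> erefl) (fun p => proj2 (ext_walk_subproof phi (svalP p))).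

Definition is_functor (D1 D2 : finDigraph) (F : hom (Walks D1) (Walks D2)) :=
  (forall v : fV D1, hE F (walk_id v) = walk_id (hV F v : fV D2)) /\
  (forall (p q : walk D1) (pq : wend p = wstart q)
     (Fpq : wend (hE F p : walk D2) = wstart (hE F q : walk D2)),
     hE F (walk_cat pq) = walk_cat Fpq).

Lemma ext_functor (D1 D2 : finDigraph) (phi : hom D1 (Walks D2)) :
  is_functor (ext phi) /\ hom_comp (walk_incl D1) (ext phi) = phi.
Proof.
split; first split.
- by move=> v; exact: walk_inj.
- move=> p q pq Fpq; apply: walk_inj => //.
  by rewrite /wedges /= /ext_edges map_cat flatten_cat.
- apply: homP => // e; apply: walk_inj.
    exact/esym/(hsrc phi e).
  by rewrite /wedges /= /ext_edges /= cats0.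
Qed.

Lemma ext_unique (D1 D2 : finDigraph) (phi : hom D1 (Walks D2))
    (F : hom (Walks D1) (Walks D2)) :
  is_functor F -> hom_comp (walk_incl D1) F = phi -> F = ext phi.
Proof.
move=> [Fid Fcat] <-; apply: homP => // -[[v s] vs].
elim: s v vs => [|e s IH] v vs.
  have -> : exist _ (v, [::]) vs = walk_id v by exact: walk_inj.
  by rewrite Fid; exact: walk_inj.
have /andP[/eqP ev es] := vs; pose q : walk D1 := exist _ (ftgt e, s) es.
have eq : wend (walk_edge e) = wstart q by [].
have -> : exist _ (v, e :: s) vs = walk_cat eq by apply: walk_inj.
have Feq : wend (hE F (walk_edge e) : walk D2) = wstart (hE F q : walk D2).
  by have := htgt F (walk_edge e); have := hsrc F q => /= -> ->.
rewrite (Fcat _ _ _ Feq); apply: walk_inj.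
  exact: (hsrc F (walk_edge e)).
by rewrite {1}/wedges /= /q IH.
Qed.

Definition gwalk (D : finDigraph) := hom Zline (Walks D).

Definition step (D : finDigraph) (w : gwalk D) (z : int) : walk D :=
  hE w (ze z).

Definition degenerate (D : finDigraph) (w : gwalk D) : Prop :=
  (exists N : int, forall n : int, N <= n -> wlen (step w n) = 0%N) \/
  (exists N : int, forall n : int, n <= N -> wlen (step w n) = 0%N).

Definition flattening (D : finDigraph) (w : gwalk D) (w0 : biwalk D) : Prop :=
  exists f : int -> int, forall z : int,
    f (z + 1) = f z + (wlen (step w z))%:Z /\
    forall j : nat, (j < wlen (step w z))%N ->
      onth (wedges (step w z)) j = Some (hE w0 (ze (f z + j%:Z))).

Definition flattenings (D : finDigraph) (w : gwalk D) : set (biwalk D) :=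
  [set w0 | flattening w w0].

Definition ndwalk (D : finDigraph) := {w : gwalk D | ~ degenerate w}.

Definition route_of (D : finDigraph) (w : ndwalk D) : set (ndwalk D) :=
  [set w' | flattenings (sval w') = flattenings (sval w)].

Definition Route (D : finDigraph) :=
  {R : set (ndwalk D) | exists w, R = route_of w}.

Definition route (D : finDigraph) (w : ndwalk D) : Route D :=
  exist _ (route_of w) (ex_intro _ w erefl).

Definition hom_degenerate (D1 D2 : finDigraph) (phi : hom D1 (Walks D2)) :=
  exists p : gwalk D1, ~ degenerate p /\ degenerate (hom_comp p (ext phi)).

(* [F] is the map phi_*, which sends the route of p to the route of p followed
   by the functor extending phi. *)
Definition is_pushforward (D1 D2 : finDigraph) (phi : hom D1 (Walks D2))
    (F : Route D1 -> Route D2) : Prop :=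
  ~ hom_degenerate phi /\
  forall (p : ndwalk D1) (q : ndwalk D2),
    sval q = hom_comp (sval p) (ext phi) -> F (route p) = route q.

Lemma is_pushforward_unique (D1 D2 : finDigraph) (phi : hom D1 (Walks D2))
    (F G : Route D1 -> Route D2) :
  is_pushforward phi F -> is_pushforward phi G -> F = G.
Proof.
move=> [nd pF] [_ pG]; apply/funext => -[R [p Rp]].
have ndp : ~ degenerate (hom_comp (sval p) (ext phi)).
  by move=> dp; apply: nd; exists (sval p); split=> //; exact: svalP p.
have -> : exist _ R (ex_intro _ p Rp) = route p by subst R.
pose q : ndwalk D2 := exist (fun w => ~ degenerate w) _ ndp.
by rewrite (pF p q) ?(pG p q).
Qed.

Definition UDAF (D : finDigraph) : Prop :=
  forall v : fV D,
    ~ (exists! h : hom (Zint `[0, +oo[) D, hV h (exist _ 0 isT) = v) /\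
    ~ (exists! h : hom (Zint `]-oo, 0]) D, hV h (exist _ 0 isT) = v).

Record udafDigraph := UdafDigraph {
  udaf_digraph :> finDigraph;
  udafP : UDAF udaf_digraph }.

Definition folding (D1 D2 : finDigraph) (phi : hom D1 (Walks D2)) : Prop :=
  exists F : Route D1 -> Route D2, is_pushforward phi F /\ bijective F.

(* An object (Route(D), D) is represented by D. *)
Inductive UDAFG :
    forall D1 D2 : udafDigraph, (Route D1 -> Route D2) -> Prop :=
| UDAFG_id (D : udafDigraph) : @UDAFG D D id
| UDAFG_comp (D1 D2 D3 : udafDigraph)
    (F : Route D1 -> Route D2) (G : Route D2 -> Route D3) :
    UDAFG F -> UDAFG G -> UDAFG (fun R => G (F R))
| UDAFG_folding (D1 D2 : udafDigraph) (phi : hom D1 (Walks D2))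
    (F : Route D1 -> Route D2) :
    folding phi -> is_pushforward phi F -> UDAFG F
| UDAFG_inv (D1 D2 : udafDigraph)
    (F : Route D1 -> Route D2) (G : Route D2 -> Route D1) :
    UDAFG F -> cancel F G -> cancel G F -> UDAFG G.

Definition elementary1 (D1 D2 : finDigraph) (f : hom D1 (Walks D2)) : Prop :=
  exists g : hom D1 D2,
    [/\ f = hom_comp g (walk_incl D2),
        injective (hV g), injective (hE g) &
        exists v : fV D2,
          [/\ ~ range (hV g) v,
              forall u : fV D2, range (hV g) u \/ u = v,
              forall e : fE D2, range (hE g) e &
              forall e : fE D2, fsrc e <> v /\ ftgt e <> v]].

(* [ES] is the edge set of a spanning subdigraph S of D1; [f] restricts to an
   isomorphism from S to D2 with the edge e removed, and maps the other edges
   bijectively to the walks of length 2 whose k-th edge (k = 0, 1) is e. *)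
Definition edge_folding (k : nat) (D1 D2 : finDigraph)
    (f : hom D1 (Walks D2)) : Prop :=
  exists (e : fE D2) (ES : set (fE D1)),
    [/\ fsrc e <> ftgt e,
        bijective (hV f : fV D1 -> fV D2),
        set_bij ES (walk_edge (D := D2) @` [set d | d <> e]) (hE f) &
        set_bij (~` ES)
          [set p : walk D2 | wlen p = 2%N /\ onth (wedges p) k = Some e]
          (hE f)].

Definition elementary (D1 D2 : udafDigraph) (f : hom D1 (Walks D2)) : Prop :=
  folding f /\ [\/ elementary1 f, edge_folding 0 f | edge_folding 1 f].

Inductive UDAFG' :
    forall D1 D2 : udafDigraph, (Route D1 -> Route D2) -> Prop :=
| UDAFG'_id (D : udafDigraph) : @UDAFG' D D id
| UDAFG'_comp (D1 D2 D3 : udafDigraph)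
    (F : Route D1 -> Route D2) (G : Route D2 -> Route D3) :
    UDAFG' F -> UDAFG' G -> UDAFG' (fun R => G (F R))
| UDAFG'_elementary (D1 D2 : udafDigraph) (phi : hom D1 (Walks D2))
    (F : Route D1 -> Route D2) :
    elementary phi -> is_pushforward phi F -> UDAFG' F
| UDAFG'_elementary_inv (D1 D2 : udafDigraph) (phi : hom D1 (Walks D2))
    (F : Route D1 -> Route D2) (G : Route D2 -> Route D1) :
    elementary phi -> is_pushforward phi F -> cancel F G -> cancel G F ->
    UDAFG' G.

Lemma UDAFG'_sub (D1 D2 : udafDigraph) (F : Route D1 -> Route D2) :
  UDAFG' F -> UDAFG F.
Proof.
elim=> {D1 D2 F}.
- exact: UDAFG_id.
- by move=> D1 D2 D3 F G _ HF _ HG; exact: UDAFG_comp.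
- by move=> D1 D2 phi F [ff _] pf; exact: UDAFG_folding ff pf.
- move=> D1 D2 phi F G [ff _] pf FG GF.
  exact: UDAFG_inv (UDAFG_folding ff pf) FG GF.
Qed.

Definition isomorphic_in
    (C : forall D1 D2 : udafDigraph, (Route D1 -> Route D2) -> Prop)
    (D1 D2 : udafDigraph) : Prop :=
  exists (F : Route D1 -> Route D2) (G : Route D2 -> Route D1),
    [/\ C D1 D2 F, C D2 D1 G, cancel F G & cancel G F].

(* Main.v *)
From mathcomp Require Import all_boot all_order all_algebra.
From mathcomp Require Import all_classical.
From mathcomp Require Import topology.
From mathcomp Require Import zify.
Require Import Defs.

Set Implicit Arguments.
Unset Strict Implicit.
Unset Printing Implicit Defensive.

Import Order.TTheory GRing.Theory Num.Theory.

Local Open Scope classical_set_scope.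
Local Open Scope ring_scope.

(** Isomorphism in the category is an equivalence relation on UDAF digraphs, and
    any chain of elementary foldings and their inverses yields one. So no
    particular isomorphism has to be found: it is enough to join D1 to D2 by
    elementary moves between finite digraphs, and to know that each move is a
    folding and that a digraph next to a UDAF digraph in the chain is UDAF.

    A route is an orbit of the shift on the bi-infinite walks: the flattenings
    of a non-degenerate walk exist and are the translates of one of them
    ([flattening_ex], [flattening_uniq]). Hence a homomorphism to walks without
    empty images is a folding as soon as each bi-infinite walk of the target is
    cut into images of edges in exactly one way. For an edge folding at a
    non-loop e the cuts can be read off locally: a place is a cut unless e lies
    just before it (respectively just after it), and e never follows itself
    ([folding_of_cuts], [fold_folding]).

    A digraph has a vertex with exactly one infinite forward walk if and only if
    it has a nonempty set of vertices that the forward walks from it never leave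
    and where they never have a choice ([loneP]). Such sets are carried along a
    move in both directions ([is_fold_lone]), and reversing all edges exchanges
    the two kinds of edge foldings; so the moves preserve the UDAF condition
    ([flow_UDAF]) and generate isomorphisms ([flow_iso]).

    Splitting a vertex v into v and a copy v' that takes over some of the edges
    out of v is a composite of moves ([out_split_flow]). Let v' first be an
    isolated vertex; give it copies of the edges in question, which is free
    since v' is a source; replace the originals by one edge from v to v', which
    is the inverse of an edge folding; finally fold this edge with the edges
    into v, which creates the edges into v'.

    It remains to prove Williams' theorem that a conjugacy decomposes into
    splittings and their inverses. A map al from the space X of bi-infinite
    walks to a finite set defines a digraph: its edges are the pairs of values
    of al at a point and at its shift. Suppose that the past of a point and the
    future of another can be joined when al agrees on them. If be refines al and
    be is a function of al and of al after the shift, then the digraph of be is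
    obtained from that of al by splittings ([refine_flow]), and likewise for the
    inverse shift ([refine_flow_past]). Apply this to the maps that read a
    window of x and a window of its image h x. Start from the window that gives
    back the essential part of D1; widen the window of x until it determines one
    symbol of h x; widen the window of h x in both directions until it
    determines the window of x; drop the latter; narrow the window of h x until
    the essential part of D2 is left ([conj_flow]). The windows are finite
    because a conjugacy is a sliding block code, by compactness
    ([uniform_window]). *)

(* The arithmetic procedure does not read the premises of the goal. *)
Ltac zlia := intros; lia.

(** * Sequences indexed by the integers *)

Lemma int_succ_ind (P : int -> Prop) :
  P 0 -> (forall z : int, P z <-> P (z + 1)) -> forall z : int, P z.
Proof.
move=> P0 PS; case; elim=> [|n IH] //.
- by (have -> : n.+1%:Z = n%:Z + 1 by zlia); exact: (PS _).1.
- exact: (PS (Negz 0)).2.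
- by apply: (PS _).2; have -> : Negz n.+1 + 1 = Negz n by zlia.
Qed.

(** Dependent choice towards both ends of the line; it produces bi-infinite walks
    from local continuation properties. *)
Lemma int_path (T : Type) (P : T -> Prop) (R : T -> T -> Prop) (t0 : T) :
  P t0 ->
  (forall t, P t -> exists2 t', P t' & R t t') ->
  (forall t, P t -> exists2 t', P t' & R t' t) ->
  exists f : int -> T,
    [/\ f 0 = t0, forall z : int, P (f z) &
        forall z : int, R (f z) (f (z + 1))].
Proof.
move=> P0 nx pv.
have {}nx (t : {t | P t}) : exists t' : {t | P t}, R (sval t) (sval t').
  by case: t => t Pt; have [t' Pt' Rt] := nx t Pt; exists (exist _ t' Pt').
have {}pv (t : {t | P t}) : exists t' : {t | P t}, R (sval t') (sval t).
  by case: t => t Pt; have [t' Pt' Rt] := pv t Pt; exists (exist _ t' Pt').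
have [n nP] := choice nx; have [p pP] := choice pv.
pose t1 : {t | P t} := exist _ t0 P0.
pose f (z : int) := match z with
  | Posz k => iter k n t1 | Negz k => iter k.+1 p t1 end.
exists (fun z => sval (f z)); split=> // [z|[k|k]].
- exact: svalP.
- by (have -> : k%:Z + 1 = k.+1%:Z by zlia); exact: nP.
- case: k => [|k]; first exact: pP.
  by (have -> : Negz k.+1 + 1 = Negz k by zlia); exact: pP.
Qed.

(** Discrete intermediate values: [f] is nondecreasing and unbounded on both
    sides, so the half-open intervals between its consecutive values cover the
    integers. *)
Lemma locate (f : int -> int) (l : int -> nat) :
  (forall z : int, f (z + 1) = f z + (l z)%:Z) ->
  (forall N : int, exists2 n : int, N <= n & (0 < l n)%N) ->
  (forall N : int, exists2 n : int, n <= N & (0 < l n)%N) ->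
  forall i : int, exists2 z : int, f z <= i & i < f (z + 1).
Proof.
move=> fS up dn i.
have mono (z : int) (k : nat) : f z <= f (z + k%:Z).
  elim: k => [|k IH]; first by rewrite addr0.
  by have := fS (z + k%:Z); (have -> : z + k.+1%:Z = z + k%:Z + 1 by zlia); zlia.
have mn (z z' : int) : z <= z' -> f z <= f z'.
  by move=> zz'; (have -> : z' = z + (absz (z' - z)%R)%:Z by zlia); exact: mono.
have [u fu] : exists u : int, i < f u.
  have H (m : nat) : exists u : int, f 0 + m%:Z <= f u.
    elim: m => [|m [u IH]]; first by exists 0; zlia.
    have [n un ln] := up u; exists (n + 1); have := mn _ _ un.
    by have := fS n; zlia.
  by have [u hu] := H (absz (i - f 0 + 1)%R); exists u; zlia.
have [d fd] : exists d : int, f d <= i.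
  have H (m : nat) : exists d : int, f d <= f 0 - m%:Z.
    elim: m => [|m [d IH]]; first by exists 0; zlia.
    have [n nd ln] := dn (d - 1); exists n.
    have nd1 : n + 1 <= d by zlia.
    by have := mn _ _ nd1; have := fS n; zlia.
  by have [d hd] := H (absz (i - f 0)%R); exists d; zlia.
have du : d < u by rewrite ltNge; apply/negP => /mn; zlia.
have [k uk] : exists k : nat, u = d + k%:Z by exists (absz (u - d)%R); zlia.
rewrite uk in fu; elim: k d fd fu {uk du} => [|k IH] d fd fu.
  by move: fu; rewrite addr0; zlia.
have [lt|ge] := ltP i (f (d + 1)); first by exists d.
by apply: (IH (d + 1)) => //; have -> : d + 1 + k%:Z = d + k.+1%:Z by zlia.
Qed.

(** * Bi-infinite walks and their flattenings *)

Definition ed (D : finDigraph) (x : biwalk D) (i : int) : fE D := hE x (ze i).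
Arguments ed : simpl never.

Definition shiftn (D : digraph) (k : int) (x : hom Zline D) : hom Zline D.
Proof.
refine (@Hom Zline D (fun v => hV x (zv (sval v + k)))
  (fun e => hE x (ze (sval e + k))) _ _) => e.
- by rewrite hsrc; congr (hV x _); exact: val_inj.
- by rewrite htgt; congr (hV x _); apply: val_inj; rewrite /= addrAC.
Defined.

Lemma zvE (v : dV Zline) : v = zv (sval v). Proof. exact: val_inj. Qed.
Lemma zeE (e : dE Zline) : e = ze (sval e). Proof. exact: val_inj. Qed.

Lemma line_src (D : digraph) (x : hom Zline D) i :
  dsrc (hE x (ze i)) = hV x (zv i).
Proof. by rewrite hsrc; congr (hV x _); exact: val_inj. Qed.

Lemma line_tgt (D : digraph) (x : hom Zline D) i :
  dtgt (hE x (ze i)) = hV x (zv (i + 1)).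
Proof. by rewrite htgt; congr (hV x _); exact: val_inj. Qed.

Lemma line_ext (D : digraph) (x y : hom Zline D) :
  (forall i : int, hE x (ze i) = hE y (ze i)) -> x = y.
Proof.
move=> xy; apply: homP => [v|e]; last by rewrite (zeE e).
by rewrite (zvE v) -!line_src xy.
Qed.

Lemma line_of (D : digraph) (x : int -> dE D) :
  (forall i : int, dtgt (x i) = dsrc (x (i + 1))) ->
  exists w : hom Zline D, forall i : int, hE w (ze i) = x i.
Proof.
move=> xP.
by exists (@Hom Zline D (fun v => dsrc (x (sval v))) (fun e => x (sval e))
  (fun=> erefl) (fun e => xP (sval e))).
Qed.

Lemma ed_path (D : finDigraph) (x : biwalk D) i :
  ftgt (ed x i) = fsrc (ed x (i + 1)).
Proof. by have /= := line_tgt x i; have /= := line_src x (i + 1) => -> ->. Qed.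

Lemma biwalk_ext (D : finDigraph) (x y : biwalk D) : ed x =1 ed y -> x = y.
Proof. by move=> xy; apply: line_ext => i; exact: xy. Qed.

Lemma biwalk_of (D : finDigraph) (x : int -> fE D) :
  (forall i : int, ftgt (x i) = fsrc (x (i + 1))) ->
  exists w : biwalk D, ed w =1 x.
Proof. by move=> /(@line_of D)[w wE]; exists w. Qed.

Lemma ed_shiftn (D : finDigraph) k (x : biwalk D) i :
  ed (shiftn k x) i = ed x (i + k).
Proof. by []. Qed.

Lemma wstart_step (D : finDigraph) (w : gwalk D) i :
  wstart (step w i) = hV w (zv i).
Proof. exact: (line_src w i). Qed.

Lemma wend_step (D : finDigraph) (w : gwalk D) i :
  wend (step w i) = wstart (step w (i + 1)).
Proof. by rewrite wstart_step; exact: (line_tgt w i). Qed.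

Lemma onth_nth (T : Type) (s : seq T) i x0 :
  (i < size s)%N -> onth s i = Some (nth x0 s i).
Proof. by elim: s i => [|x s IH] [|i] //= /IH. Qed.

Lemma nondegP (D : finDigraph) (w : gwalk D) :
  ~ degenerate w <->
  (forall N : int, exists2 n : int, N <= n & (0 < wlen (step w n))%N) /\
  (forall N : int, exists2 n : int, n <= N & (0 < wlen (step w n))%N).
Proof.
split=> [nd|[up dn] [[N H]|[N H]]].
- split=> N; apply: contrapT => H; apply: nd; [left|right]; exists N => n nN;
    apply/eqP; rewrite -leqn0 leqNgt; apply/negP => ln; apply: H; by exists n.
- by have [n Nn] := up N; rewrite H.
- by have [n Nn] := dn N; rewrite H.
Qed.

Lemma positions (l : int -> nat) :
  exists f : int -> int, forall z : int, f (z + 1) = f z + (l z)%:Z.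
Proof.
have [||f [f0 _ fS]] := @int_path (int * int) (fun=> True)
  (fun t t' => t'.1 = t.1 + 1 /\ t'.2 = t.2 + (l t.1)%:Z) (0, 0) I.
- by move=> [z v] _; exists (z + 1, v + (l z)%:Z).
- by move=> [z v] _; exists (z - 1, v - (l (z - 1)%R)%:Z) => //=; split; zlia.
have f1 : forall z : int, (f z).1 = z.
  apply: int_succ_ind => [|z]; first by rewrite f0.
  by have [-> _] := fS z; split; zlia.
by exists (fun z => (f z).2) => z; have [_ ->] := fS z; rewrite f1.
Qed.

Lemma walk_inner (D : finDigraph) (p : walk D) i e e' :
  onth (wedges p) i = Some e -> onth (wedges p) i.+1 = Some e' ->
  ftgt e = fsrc e'.
Proof.
move=> ie ie'; have /is_walkP/(_ _ _ ie') := svalP p.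
by rewrite /= onth_map -/(wedges p) ie /= => -[].
Qed.

Lemma walk_first (D : finDigraph) (p : walk D) e :
  onth (wedges p) 0 = Some e -> fsrc e = wstart p.
Proof. by move=> ie; have /is_walkP/(_ _ _ ie) /= [<-] := svalP p. Qed.

Lemma walk_last (D : finDigraph) (p : walk D) i e :
  wlen p = i.+1 -> onth (wedges p) i = Some e -> ftgt e = wend p.
Proof.
rewrite /wlen /wend => sp; case/lastP: (wedges p) sp => // s d.
rewrite size_rcons => -[<-]; rewrite (onth_nth d) ?size_rcons //.
by rewrite nth_rcons ltnn eqxx => -[<-]; rewrite map_rcons last_rcons.
Qed.

(** Steps of length 0 do not move the current vertex; this bridges the gap
    between two consecutive edges of a flattening that come from distant steps. *)
Lemma start_const (D : finDigraph) (w : gwalk D) (f : int -> int) :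
  (forall z : int, f (z + 1) = f z + (wlen (step w z))%:Z) ->
  forall z (k : nat), f (z + k%:Z) = f z ->
  wstart (step w (z + k%:Z)) = wstart (step w z).
Proof.
move=> fS z; have mono (k : nat) : f z <= f (z + k%:Z).
  elim: k => [|k IH]; first by rewrite addr0.
  by have := fS (z + k%:Z); (have -> : z + k.+1%:Z = z + k%:Z + 1 by zlia); zlia.
elim=> [|k IH]; first by rewrite addr0.
have -> : z + k.+1%:Z = z + k%:Z + 1 by zlia.
rewrite fS -wend_step => fk; have := mono k => fk'.
have l0 : wlen (step w (z + k%:Z)) = 0%N by zlia.
rewrite /wend (size0nil l0) /= IH //; zlia.
Qed.

(** With [f z] the signed number of edges before step z, position i belongs to
    the step z with [f z <= i < f (z + 1)]. *)
Lemma flattening_ex (D : finDigraph) (w : gwalk D) :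
  ~ degenerate w -> exists w0, flattening w w0.
Proof.
move=> /nondegP[up dn].
have [f fS] := positions (fun z => wlen (step w z)).
have loc := locate fS up dn.
have mn (z z' : int) : z <= z' -> f z <= f z'.
  move=> zz'; have -> : z' = z + (absz (z' - z)%R)%:Z by zlia.
  elim: (absz _) => [|k IH]; first by rewrite addr0.
  by have := fS (z + k%:Z); (have -> : z + k.+1%:Z = z + k%:Z + 1 by zlia); zlia.
have ex i : exists e : fE D, exists2 z : int, f z <= i < f (z + 1) &
    onth (wedges (step w z)) (absz (i - f z)%R) = Some e.
  have [z zi iz] := loc i; have := fS z => fz.
  have lt : (absz (i - f z)%R < size (wedges (step w z)))%N.
    by rewrite -/(wlen _); zlia.
  have : onth (wedges (step w z)) (absz (i - f z)%R) by rewrite onthTE.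
  by case E: onth => [e|] // _; exists e; exists z; rewrite ?zi.
have [x xP] := choice ex.
have xE z (j : nat) : (j < wlen (step w z))%N ->
    onth (wedges (step w z)) j = Some (x (f z + j%:Z)).
  move=> jl; have [z' /andP[z1 z2]] := xP (f z + j%:Z); have := fS z => fz.
  have -> : z' = z.
    apply/eqP; rewrite eq_le; apply/andP; split; rewrite leNgt; apply/negP => zz.
      by have := mn (z + 1) z' ltac:(zlia); zlia.
    by have := mn (z' + 1) z ltac:(zlia); zlia.
  by have -> : (absz (f z + j%:Z - f z)%R) = j by zlia.
have [w0 w0E] : exists w0 : biwalk D, ed w0 =1 x.
  apply: biwalk_of => i; have [z zi iz] := loc i; have := fS z => fz.
  have Ei : x i = x (f z + (absz (i - f z)%R)%:Z) by congr x; zlia.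
  have ltl : ((absz (i - f z)%R) < wlen (step w z))%N by zlia.
  have [lt|ge] := ltP (i + 1) (f (z + 1)).
    apply: (@walk_inner _ (step w z) (absz (i - f z)%R)).
      by rewrite Ei xE.
    by rewrite xE; [congr (Some (x _)); zlia|zlia].
  rewrite (@walk_last _ (step w z) (absz (i - f z)%R)); [|zlia|by rewrite Ei xE].
  have [z' zi' iz'] := loc (i + 1); have := fS z' => fz'.
  have zz' : z + 1 <= z'.
    rewrite leNgt; apply/negP => zz.
    by have := mn (z' + 1) (z + 1) ltac:(zlia); zlia.
  have fzz := mn _ _ zz'.
  rewrite (@walk_first _ (step w z') (x (i + 1))); last first.
    by rewrite xE; [congr (Some (x _)); zlia|zlia].
  rewrite wend_step; have zk : z' = z + 1 + (absz (z' - (z + 1))%R)%:Z by zlia.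
  by rewrite zk (start_const fS) // -zk; zlia.
exists w0, f => z; split=> // j jl; rewrite xE //.
by have := w0E (f z + j%:Z); rewrite /ed => <-.
Qed.

Lemma flattening_shift (D : finDigraph) (w : gwalk D) k w0 :
  flattening w w0 -> flattening w (shiftn k w0).
Proof.
move=> [f fP]; exists (fun z => f z - k) => z; have [fS fE] := fP z.
split=> [|j jl]; first by zlia.
by rewrite fE //; congr (Some (hE w0 (ze _))); rewrite /=; zlia.
Qed.

(** Two position functions have the same increments, so they differ by a
    constant. *)
Lemma flattening_uniq (D : finDigraph) (w : gwalk D) w0 w1 :
  ~ degenerate w -> flattening w w0 -> flattening w w1 ->
  exists k, w1 = shiftn k w0.
Proof.
move=> /nondegP[up dn] [f fP] [g gP].
have fS z := (fP z).1; have gS z := (gP z).1.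
have fg : forall z : int, f z - g z = f 0 - g 0.
  by apply: int_succ_ind => // z; rewrite fS gS; zlia.
exists (f 0 - g 0); apply: biwalk_ext => i; rewrite ed_shiftn.
have [z zi iz] := locate gS up dn i; have := gS z => gz.
have jl : ((absz (i - g z)%R) < wlen (step w z))%N by zlia.
have := (fP z).2 _ jl; rewrite (gP z).2 // => -[] /esym; rewrite /ed.
have -> : g z + (absz (i - g z)%R)%:Z = i by zlia.
by move=> <-; congr (hE w0 (ze _)); have := fg z; zlia.
Qed.

(** Each of the two sets is one orbit of the shift, and they meet. *)
Lemma flattenings_eq (D : finDigraph) (w w' : gwalk D) x :
  ~ degenerate w -> ~ degenerate w' -> flattening w x -> flattening w' x ->
  flattenings w = flattenings w'.
Proof.
move=> nw nw' wx wx'; apply/seteqP; split=> y /= wy.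
  by have [k ->] := flattening_uniq nw wx wy; exact: flattening_shift.
by have [k ->] := flattening_uniq nw' wx' wy; exact: flattening_shift.
Qed.

Lemma route_eq (D : finDigraph) (p q : ndwalk D) :
  route p = route q <-> flattenings (sval p) = flattenings (sval q).
Proof.
split=> [[pq]|pq]; last by apply: eq_exist; rewrite /route_of pq.
by have : route_of p p by []; rewrite pq.
Qed.

Lemma route_sur (D : finDigraph) (R : Route D) : exists p, R = route p.
Proof. by case: R => R [p Rp]; exists p; exact: eq_exist. Qed.

(** * Foldings from unique parsing *)

Lemma inj_surj_bij (T U : Type) (f : T -> U) :
  injective f -> (forall u, exists t, f t = u) -> bijective f.
Proof. by move=> fi /choice[g gK]; exists g => // t; apply: fi; rewrite gK. Qed.

Lemma incl_flattening (D : finDigraph) (x : biwalk D) :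
  ~ degenerate (hom_comp x (walk_incl D) : gwalk D) /\
  flattening (hom_comp x (walk_incl D)) x.
Proof.
split; first by apply/nondegP; split=> N; exists N.
exists id => z; split=> // -[|j] //= _.
by rewrite addr0.
Qed.

Lemma step_comp (D1 D2 : finDigraph) (p : gwalk D1) (phi : hom D1 (Walks D2)) z :
  wedges (step (hom_comp p (ext phi)) z) = ext_edges phi (wedges (step p z)).
Proof. by []. Qed.

Lemma ext_edges_rcons (D1 D2 : finDigraph) (phi : hom D1 (Walks D2)) s d :
  ext_edges phi (rcons s d) = ext_edges phi s ++ wedges (hE phi d).
Proof.
by rewrite /ext_edges -cats1 map_cat flatten_cat /= cats0.
Qed.

Lemma onth_cat (T : Type) (s t : seq T) i :
  onth (s ++ t) i = if (i < size s)%N then onth s i else onth t (i - size s).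
Proof. by elim: s i => [|x s IH] [|i] //=; rewrite ?subn0 //= IH. Qed.

(** The position functions compose, because the functor extending phi sends
    concatenations to concatenations. *)
Lemma flattening_comp (D1 D2 : finDigraph) (phi : hom D1 (Walks D2))
    (p : gwalk D1) (x : biwalk D1) (y : biwalk D2) :
  flattening p x -> flattening (hom_comp x phi) y ->
  flattening (hom_comp p (ext phi)) y.
Proof.
move=> [f fP] [g gP]; exists (g \o f) => z; have [fS fE] := fP z.
rewrite /wlen step_comp /=; set s := wedges _ in fE *.
suff H n : (n <= size s)%N ->
    g (f z + n%:Z) = g (f z) + (size (ext_edges phi (take n s)))%:Z /\
    forall j, (j < size (ext_edges phi (take n s)))%N ->
      onth (ext_edges phi (take n s)) j = Some (hE y (ze (g (f z) + j%:Z))).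
  by have := H _ (leqnn _); rewrite take_size fS.
elim: n => [_|n IH ln]; first by rewrite take0 addr0 /=; split=> //; rewrite addr0.
have [gn en] := IH (ltnW ln); have [gS gE] := gP (f z + n%:Z).
have fn := fE n ln; have := fn; rewrite (onth_nth (ed x (f z + n%:Z))) // => -[nE].
rewrite (take_nth (ed x (f z + n%:Z))) // ext_edges_rcons size_cat nE.
have -> : f z + n.+1%:Z = f z + n%:Z + 1 by zlia.
split; first by rewrite gS gn PoszD addrA.
move=> j jl; rewrite onth_cat; case: ltnP => jn; first exact: en.
rewrite (gE (j - size (ext_edges phi (take n s)))%N); last first.
  by move: jl jn; rewrite -/(wlen _); rewrite /wlen /step /ed /=; zlia.
congr (Some (hE y (ze _))); rewrite gn; zlia.
Qed.

Lemma size_ext_edges (D1 D2 : finDigraph) (phi : hom D1 (Walks D2)) s :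
  (forall d : fE D1, (0 < wlen (hE phi d : walk D2))%N) ->
  (size s <= size (ext_edges phi s))%N.
Proof.
move=> pos; elim: s => //= d s IH; rewrite /ext_edges /= size_cat.
by rewrite -/(ext_edges phi s) -/(wlen _); have := pos d; zlia.
Qed.

Lemma nondeg_comp (D1 D2 : finDigraph) (phi : hom D1 (Walks D2)) (p : gwalk D1) :
  (forall d : fE D1, (0 < wlen (hE phi d : walk D2))%N) ->
  ~ degenerate p -> ~ degenerate (hom_comp p (ext phi)).
Proof.
move=> pos /nondegP[up dn]; apply/nondegP; split=> N.
  have [n Nn ln] := up N; exists n => //; rewrite /wlen step_comp.
  exact: leq_trans ln (size_ext_edges _ pos).
have [n Nn ln] := dn N; exists n => //; rewrite /wlen step_comp.
exact: leq_trans ln (size_ext_edges _ pos).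
Qed.

Lemma nondeg_biwalk (D1 D2 : finDigraph) (phi : hom D1 (Walks D2)) (x : biwalk D1) :
  (forall d : fE D1, (0 < wlen (hE phi d : walk D2))%N) ->
  ~ degenerate (hom_comp x phi).
Proof. by move=> pos; apply/nondegP; split=> N; exists N => //; exact: pos. Qed.

(** Routes are shift orbits of bi-infinite walks, so a homomorphism without
    empty images is a folding as soon as every bi-infinite walk of D2 is
    spelled out by the image of a bi-infinite walk of D1, unique up to shift. *)
Lemma folding_of_parse (D1 D2 : finDigraph) (phi : hom D1 (Walks D2)) :
  (forall d : fE D1, (0 < wlen (hE phi d : walk D2))%N) ->
  (forall y : biwalk D2, exists x : biwalk D1, flattening (hom_comp x phi) y) ->
  (forall (y : biwalk D2) (x x' : biwalk D1),
     flattening (hom_comp x phi) y -> flattening (hom_comp x' phi) y ->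
     exists k, x' = shiftn k x) ->
  folding phi.
Proof.
move=> pos sur inj.
pose push (p : ndwalk D1) : ndwalk D2 :=
  exist (fun w => ~ degenerate w) _ (nondeg_comp pos (svalP p)).
have pushE (p : ndwalk D1) (x : biwalk D1) (y : biwalk D2) :
    flattening (sval p) x -> flattening (hom_comp x phi) y ->
    flattenings (sval (push p)) = flattenings (hom_comp x phi).
  move=> px xy; apply: (@flattenings_eq _ _ _ y) => //.
  - exact: svalP (push p).
  - exact: nondeg_biwalk.
  - exact: flattening_comp px xy.
have flex (D : finDigraph) (p : ndwalk D) : exists x, flattening (sval p) x.
  exact: flattening_ex (svalP p).
have xyex (x : biwalk D1) : exists y, flattening (hom_comp x phi) y.
  exact/flattening_ex/nondeg_biwalk.
have pushR p q : route p = route q -> route (push p) = route (push q).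
  move=> /route_eq pq; apply/route_eq.
  have [x px] := flex _ p; have [y xy] := xyex x.
  have qx : flattening (sval q) x.
    by have : flattenings (sval p) x by []; rewrite pq.
  by rewrite (pushE _ _ _ px xy) (pushE _ _ _ qx xy).
have [r rP] := choice (@route_sur D1).
pose F R := route (push (r R)).
have FE p : F (route p) = route (push p).
  by apply: pushR; rewrite -rP.
exists F; split.
  split; first by move=> [p [np]]; exact: (svalP (push (exist _ p np))).
  move=> p q qE; rewrite FE; congr route.
  by case: q qE => q nq /= qE; exact: eq_exist.
apply: inj_surj_bij.
- move=> R S; have [p ->] := route_sur R; have [q ->] := route_sur S.
  rewrite !FE => /route_eq pq; apply/route_eq.
  have [x px] := flex _ p; have [x' qx] := flex _ q.
  have [y xy] := xyex x; have [y' xy'] := xyex x'.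
  rewrite (pushE _ _ _ px xy) (pushE _ _ _ qx xy') in pq.
  have xy2 : flattening (hom_comp x' phi) y.
    by have : flattenings (hom_comp x phi) y by []; rewrite pq.
  have [k xk] := inj _ _ _ xy xy2.
  apply: (flattenings_eq (svalP p) (svalP q) _ qx).
  by rewrite xk; exact: flattening_shift.
- move=> R; have [q ->] := route_sur R; have [y qy] := flex _ q.
  have [x xy] := sur y; have [nx xx] := incl_flattening x.
  pose p : ndwalk D1 := exist (fun w => ~ degenerate w) _ nx.
  exists (route p); rewrite FE; apply/route_eq.
  apply: (flattenings_eq (svalP (push p)) (svalP q) _ qy).
  exact: flattening_comp xx xy.
Qed.

Definition reads (D : finDigraph) (y : biwalk D) (i : int) (p : walk D) : Prop :=
  forall j : nat, (j < wlen p)%N -> onth (wedges p) j = Some (ed y (i + j%:Z)).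

Definition cut_at (D : finDigraph) (cut : fE D -> fE D -> Prop) (y : biwalk D)
  (i : int) : Prop := cut (ed y (i - 1)) (ed y i).

Lemma reads_start (D : finDigraph) (y : biwalk D) i p :
  reads y i p -> (0 < wlen p)%N -> wstart p = fsrc (ed y i).
Proof.
move=> yp p0; have := yp 0%N p0; rewrite addr0 => /walk_first <-.
by [].
Qed.

Lemma reads_end (D : finDigraph) (y : biwalk D) i p :
  reads y i p -> (0 < wlen p)%N -> wend p = fsrc (ed y (i + (wlen p)%:Z)).
Proof.
move=> yp p0; have pl : ((wlen p).-1 < wlen p)%N by zlia.
rewrite -(walk_last _ (yp _ pl)); last by zlia.
by rewrite ed_path; congr (fsrc (ed y _)); zlia.
Qed.

(** A cut is a place between two edges of D2. The hypotheses say that the two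
    edges alone decide whether a block, that is the image of an edge of D1, may
    end there ([cut_between], [cut_inside]), and that every block can be
    continued on both sides from cut to cut ([parse_next], [parse_prev]). *)
Section Parsing.
Variables (D1 D2 : finDigraph) (phi : hom D1 (Walks D2)).
Variable cut : fE D2 -> fE D2 -> Prop.
Notation im d := (hE phi (d : fE D1) : walk D2).

Hypothesis Vinj : injective (hV phi).
Hypothesis Einj : injective (hE phi).
Hypothesis pos : forall d : fE D1, (0 < wlen (im d))%N.
Hypothesis cut_between : forall (d d' : fE D1) (a b : fE D2),
  onth (wedges (im d)) (wlen (im d)).-1 = Some a ->
  onth (wedges (im d')) 0 = Some b -> cut a b.
Hypothesis cut_inside : forall (d : fE D1) (i : nat) (a b : fE D2),
  onth (wedges (im d)) i = Some a -> onth (wedges (im d)) i.+1 = Some b ->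
  ~ cut a b.
Hypothesis cut_some : forall y : biwalk D2, exists i, cut_at cut y i.
Hypothesis parse_next : forall (y : biwalk D2) (i : int), cut_at cut y i ->
  exists2 d : fE D1, reads y i (im d) & cut_at cut y (i + (wlen (im d))%:Z).
Hypothesis parse_prev : forall (y : biwalk D2) (i : int), cut_at cut y i ->
  exists2 d : fE D1, reads y (i - (wlen (im d))%:Z) (im d) &
    cut_at cut y (i - (wlen (im d))%:Z).

Lemma parse_ex (y : biwalk D2) :
  exists x : biwalk D1, flattening (hom_comp x phi) y.
Proof.
have [i0 cut0] := cut_some y; have [d0 rd0 cut1] := parse_next cut0.
have [||f [_ fP fS]] := @int_path (int * fE D1)
  (fun t => [/\ cut_at cut y t.1, reads y t.1 (im t.2) &
                cut_at cut y (t.1 + (wlen (im t.2))%:Z)])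
  (fun t t' => t'.1 = t.1 + (wlen (im t.2))%:Z) (i0, d0) (And3 cut0 rd0 cut1).
- move=> [i d] /= [_ _ ci]; have [d' rd' c'] := parse_next ci.
  by exists (i + (wlen (im d))%:Z, d').
- move=> [i d] /= [ci _ _]; have [d' rd' c'] := parse_prev ci.
  exists (i - (wlen (im d'))%:Z, d') => /=; last by rewrite subrK.
  by split=> //; rewrite subrK.
have [x xE] : exists x : biwalk D1, ed x =1 fun z => (f z).2.
  apply: biwalk_of => z; apply: Vinj; have [_ rz _] := fP z.
  have [_ rz1 _] := fP (z + 1).
  have := htgt phi (f z).2; rewrite /= => <-.
  have := hsrc phi (f (z + 1)).2; rewrite /= => <-.
  by rewrite (reads_end rz) // (reads_start rz1) // fS.
exists x, (fun z => (f z).1) => z.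
have -> : step (hom_comp x phi) z = im (f z).2 by rewrite -xE.
by split=> [|j jl]; [exact: fS|have [_ rz _] := fP z; exact: rz].
Qed.

Section Parsed.
Variables (y : biwalk D2) (x : biwalk D1) (f : int -> int).
Hypothesis fP : forall z : int,
  f (z + 1) = f z + (wlen (im (ed x z)))%:Z /\ reads y (f z) (im (ed x z)).

Lemma parsed_cut z : cut_at cut y (f z).
Proof.
have := fP (z - 1); rewrite subrK => -[fz rz].
have p1 := pos (ed x (z - 1)).
have rl := rz (wlen (im (ed x (z - 1)))).-1 ltac:(zlia).
have [_ rz0] := fP z; have r0 := rz0 0%N (pos _).
rewrite /cut_at; move: (cut_between rl r0).
by congr cut; congr (ed y _); zlia.
Qed.

(** A cut that is not the end of a block would lie inside one. *)
Lemma cut_parsed i : cut_at cut y i -> exists z, i = f z.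
Proof.
have fS z := (fP z).1; move=> ci.
have [||z zi iz] := @locate f (fun z => wlen (im (ed x z))) fS _ _ i.
- by move=> N; exists N.
- by move=> N; exists N.
exists z; apply/eqP; rewrite eq_le zi andbT leNgt; apply/negP => lt.
have fz := fS z; have [_ rz] := fP z.
have [j ij] : exists j : nat, i = f z + j.+1%:Z.
  by exists (absz (i - f z)%R).-1; zlia.
have jl : (j.+1 < wlen (im (ed x z)))%N by zlia.
apply: (cut_inside (rz j ltac:(zlia)) (rz _ jl)).
by move: ci; rewrite /cut_at ij; congr cut; congr (ed y _); zlia.
Qed.

Lemma parsed_mono (z z' : int) : z < z' -> f z < f z'.
Proof.
have H (k : nat) : f z < f (z + k.+1%:Z).
  elim: k => [|k IH].
    by have [-> _] := fP z; have := pos (ed x z); zlia.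
  have := pos (ed x (z + k.+1%:Z)); have [+ _] := fP (z + k.+1%:Z).
  have -> : z + k.+2%:Z = z + k.+1%:Z + 1 by zlia.
  by move=> ->; zlia.
move=> zz'; have -> : z' = z + (absz (z' - z)%R).-1.+1%:Z by zlia.
exact: H.
Qed.

Lemma parsed_inj : injective f.
Proof.
move=> z z' ff; apply/eqP; rewrite eq_le !leNgt.
by apply/andP; split; apply/negP => /parsed_mono; rewrite ff ltxx.
Qed.

Lemma parsed_next z i : cut_at cut y i -> f z < i -> f (z + 1) <= i.
Proof.
move=> /cut_parsed[w ->] fzw; rewrite leNgt; apply/negP => lt.
have zw : z < w.
  rewrite ltNge; apply/negP; rewrite le_eqVlt => /orP[/eqP wz|/parsed_mono].
    by rewrite wz ltxx in fzw.
  by zlia.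
have : w < z + 1.
  rewrite ltNge; apply/negP; rewrite le_eqVlt => /orP[/eqP wz|/parsed_mono].
    by rewrite wz ltxx in lt.
  by zlia.
by zlia.
Qed.

End Parsed.

(** Both parsings have the cuts of y as their block ends, so their position
    functions are increasing bijections onto the same set and differ by a
    translation of the index. *)
Lemma parse_uniq (y : biwalk D2) (x x' : biwalk D1) :
  flattening (hom_comp x phi) y -> flattening (hom_comp x' phi) y ->
  exists k, x' = shiftn k x.
Proof.
move=> [f fP] [g gP].
have nxt z w : g z = f w -> g (z + 1) = f (w + 1).
  move=> gf; apply/eqP; rewrite eq_le.
  rewrite (parsed_next gP (parsed_cut fP _)) ?(parsed_next fP (parsed_cut gP _)) //.
    by rewrite -gf (parsed_mono gP) //; zlia.
  by rewrite gf (parsed_mono fP) //; zlia.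
have /choice[k kP] (z : int) : exists w : int, g z = f w.
  by apply: (cut_parsed fP); exact: (parsed_cut gP).
have kE : forall z : int, k z = z + k 0.
  apply: int_succ_ind => [|z]; first by rewrite add0r.
  have -> : k (z + 1) = k z + 1.
    by apply: (parsed_inj fP); rewrite -kP; apply: nxt.
  by split; zlia.
exists (k 0); apply: biwalk_ext => z; rewrite ed_shiftn -kE; apply: Einj.
have [gz rg] := gP z; have [fz rf] := fP (k z).
rewrite -(nxt _ _ (kP z)) gz kP in fz.
have sz : wlen (im (ed x' z)) = wlen (im (ed x (k z))).
  by move: fz; rewrite /step /ed /=; zlia.
apply: walk_inj.
  rewrite (@reads_start _ y (g z) (im (ed x' z)) rg (pos _)).
  by rewrite (@reads_start _ y (f (k z)) (im (ed x (k z))) rf (pos _)) kP.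
apply: eq_from_onth => j.
have [jl|jl] := ltnP j (wlen (im (ed x' z))).
  by rewrite (rg j jl) (rf j) ?kP // -sz.
by rewrite !onth_default // -/(wlen _) -?sz.
Qed.

Lemma folding_of_cuts : folding phi.
Proof. exact: folding_of_parse pos parse_ex parse_uniq. Qed.

End Parsing.

(** * Elementary moves between digraphs *)

(** The walks of length 2 with e in place k, as lists of edges. *)
Definition block (T : Type) (k : bool) (e f : T) : seq T :=
  if k then [:: f; e] else [:: e; f].

(** The data of an edge folding with all the dependent types removed: [fe d] is
    the list of edges of the walk that is the image of d. *)
Record fold_at (k : bool) (D1 D2 : finDigraph) (e : fE D2)
    (fv : fV D1 -> fV D2) (fe : fE D1 -> seq (fE D2)) : Prop := FoldAt {
  fold_nloop : fsrc e <> ftgt e;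
  fold_bij : bijective fv;
  fold_inj : injective fe;
  fold_src : forall d, is_walk (fv (fsrc d)) (fe d);
  fold_tgt : forall d, last (fv (fsrc d)) (map (@ftgt D2) (fe d)) = fv (ftgt d);
  fold_block : forall d, (exists2 f, f <> e & fe d = [:: f]) \/
    (exists f, fe d = block k e f);
  fold_single : forall f, f <> e -> exists d, fe d = [:: f];
  fold_pair : forall f, (if k then ftgt f = fsrc e else ftgt e = fsrc f) ->
    exists d, fe d = block k e f }.

Definition is_fold (k : bool) (D1 D2 : finDigraph) : Prop :=
  exists (e : fE D2) fv fe, @fold_at k D1 D2 e fv fe.

(** D2 is D1 with one more vertex, which is isolated since all edges of D2 come
    from D1. *)
Definition is_add1 (D1 D2 : finDigraph) : Prop :=
  exists (gv : fV D1 -> fV D2) (ge : fE D1 -> fE D2),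
    [/\ injective gv, bijective ge,
        forall d, fsrc (ge d) = gv (fsrc d) /\ ftgt (ge d) = gv (ftgt d) &
        exists2 v, (forall u, gv u <> v) & forall u, u = v \/ exists u', gv u' = u].

Lemma block_walk (D : finDigraph) k (e f : fE D) v :
  is_walk v (block k e f) -> (if k then ftgt f = fsrc e else ftgt e = fsrc f).
Proof. by case: k => /= /and3P[_ /eqP]. Qed.

Section FoldHom.
Variables (D1 D2 : finDigraph) (fv : fV D1 -> fV D2) (fe : fE D1 -> seq (fE D2)).
Hypothesis src : forall d, is_walk (fv (fsrc d)) (fe d).
Hypothesis tgt : forall d,
  last (fv (fsrc d)) (map (@ftgt D2) (fe d)) = fv (ftgt d).

Definition seq_hom : hom D1 (Walks D2) :=
  @Hom D1 (Walks D2) fv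
    (fun d => exist (fun p => is_walk p.1 p.2) (fv (fsrc d), fe d) (src d))
    (fun=> erefl) tgt.

Lemma wedges_seq_hom (d : fE D1) : wedges (hE seq_hom d : walk D2) = fe d.
Proof. by []. Qed.

Lemma seq_hom_inj : injective fe -> injective (hE seq_hom).
Proof. by move=> fi d d' dd'; apply: fi; rewrite -!wedges_seq_hom dd'. Qed.

Lemma reads_cat (y : biwalk D2) i (d : fE D1) (s : seq (fE D2)) :
  fe d = s -> (forall j a, onth s j = Some a -> a = ed y (i + j%:Z)) ->
  reads y i (hE seq_hom d : walk D2).
Proof.
move=> <- H j; rewrite /wlen wedges_seq_hom => jl.
case E : (onth (fe d) j) => [a|]; first by rewrite -(H _ _ E).
by have := onthTE (fe d) j; rewrite E jl.
Qed.

End FoldHom.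

Lemma no_repeat (D : finDigraph) (e : fE D) (y : biwalk D) i :
  fsrc e <> ftgt e -> ed y i = e -> ed y (i + 1) <> e.
Proof. by move=> ne yi yi1; apply: ne; rewrite -[in RHS]yi ed_path yi1. Qed.

(** In a bi-infinite walk of D2 each occurrence of the non-loop e is merged with
    the edge after it (or before it, if k), and e never follows itself; so the
    parsing is forced: the cuts are the places not just after e (not just
    before e, if k). *)
Lemma fold_folding k (D1 D2 : finDigraph) e fv fe 
    (H : @fold_at k D1 D2 e fv fe) :
  folding (seq_hom (fold_src H) (fold_tgt H)).
Proof.
have bw d f : fe d = block k e f ->
    if k then ftgt f = fsrc e else ftgt e = fsrc f.
  move=> df; apply: (@block_walk _ k e f (fv (fsrc d))).
  by rewrite -df; exact: (fold_src H).
have nf d f : fe d = block k e f -> f <> e.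
  by move=> /bw + fe0; rewrite fe0; have := fold_nloop H; case: (k) => // ? /esym.
have nr y i := @no_repeat D2 e y i (fold_nloop H).
have nr' y i : ed y i = e -> ed y (i - 1) <> e.
  by move=> yi yi1; apply: (nr _ _ yi1); rewrite subrK.
pose im d := hE (seq_hom (fold_src H) (fold_tgt H)) d : walk D2.
have rd y i d s : fe d = s ->
    (forall j a, onth s j = Some a -> a = ed y (i + j%:Z)) -> reads y i (im d).
  exact: reads_cat.
pose cut a b := (if k then b else a) <> e.
apply: (@folding_of_cuts _ _ _ cut).
- exact/bij_inj/(fold_bij H).
- exact: seq_hom_inj (fold_inj H).
- move=> d; rewrite /wlen wedges_seq_hom.
  by have [[f _ ->]|[f ->]] := fold_block H d => //; rewrite /block; case: (k).
- move=> d d' a b; rewrite /wlen !wedges_seq_hom /cut; case: (k) (H) (nf) => H' nf'.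
  + move=> _; have [[f fe0 ->]|[f df]] := fold_block H' d'; first by move=> /= [<-].
    by have := nf' _ _ df; rewrite df /= => ? [<-].
  + move=> + _; have [[f fe0 ->]|[f df]] := fold_block H' d; first by move=> /= [<-].
    by have := nf' _ _ df; rewrite df /= => ? [<-].
- move=> d i a b; rewrite !wedges_seq_hom /cut.
  have [[f _ ->]|[f ->]] := fold_block H d; first by case: i => [|[]].
  by rewrite /block; case: (k); case: i => [|[]] //= [ea] [eb] n; apply: n.
- move=> y; rewrite /cut_at /cut.
  (* of two consecutive edges one is not e *)
  have [y0|y0] := pselect (ed y 0 = e); last first.
    by exists (if k then 0 else 1); case: (k) => //; rewrite subrr.
  exists (if k then 1 else 2); have := nr _ _ y0; rewrite add0r; case: (k) => //.
- move=> y i; rewrite /cut_at /cut => ci.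
  (* the block that starts at i is a pair iff e is its edge in place k *)
  have [yi|yi] := pselect (ed y (if k then i + 1 else i) = e).
    have [|d fd] := @fold_pair _ _ _ _ _ _ H (ed y (if k then i else i + 1)).
      by destruct k; move: yi => /= <-; exact: ed_path.
    exists d.
      apply: (rd _ _ _ _ fd) => j a; rewrite /block.
      by destruct k; case: j => [|[|[]]] //= [<-]; rewrite ?addr0 ?yi.
    rewrite /im /wlen wedges_seq_hom fd; destruct k => /=.
      by rewrite (_ : i + 2 = i + 1 + 1); [exact: nr|zlia].
    by rewrite (_ : i + 2 - 1 = i + 1); [exact: nr|zlia].
  have [|d fd] := @fold_single _ _ _ _ _ _ H (ed y i); first by destruct k.
  exists d.
    by apply: (rd _ _ _ _ fd) => -[|[]] //= a [<-]; rewrite addr0.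
  rewrite /im /wlen wedges_seq_hom fd; destruct k => //=.
  by rewrite addrK.
- move=> y i; rewrite /cut_at /cut => ci.
  (* the block that ends at i is a pair iff e is its edge in place k *)
  have [yi|yi] := pselect (ed y (if k then i - 1 else i - 2) = e).
    have [|d fd] := @fold_pair _ _ _ _ _ _ H (ed y (if k then i - 2 else i - 1)).
      by destruct k; move: yi => /= <-; rewrite ed_path; congr (fsrc (ed y _)); zlia.
    exists d.
      apply: (rd _ _ _ _ fd) => j a.
      rewrite /im /wlen wedges_seq_hom fd /block; destruct k.
        by case: j => [|[|[]]] //= [<-]; rewrite -?yi; congr (ed y _); zlia.
      by case: j => [|[|[]]] //= [<-]; rewrite -?yi; congr (ed y _); zlia.
    rewrite /im /wlen wedges_seq_hom fd; destruct k => /=.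
      by rewrite (_ : i - 2 = i - 1 - 1); [exact: nr'|zlia].
    exact: nr'.
  have [|d fd] := @fold_single _ _ _ _ _ _ H (ed y (i - 1)); first by destruct k.
  exists d.
    rewrite /im /wlen wedges_seq_hom fd.
    by apply: (rd _ _ _ _ fd) => -[|[]] //= a [<-]; rewrite addr0.
  rewrite /im /wlen wedges_seq_hom fd; destruct k => //=.
  by have -> : i - 1 - 1 = i - 2 by zlia.
Qed.

Lemma fold_edge_folding k (D1 D2 : finDigraph) e fv fe
    (H : @fold_at k D1 D2 e fv fe) :
  edge_folding k (seq_hom (fold_src H) (fold_tgt H)).
Proof.
set phi := seq_hom _ _.
have phi_inj : injective (hE phi) by apply: seq_hom_inj; exact: fold_inj H.
have bs f : size (block k e f) = 2 by rewrite /block; case: (k).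
exists e, [set d | size (fe d) = 1%N]; split.
- exact: fold_nloop H.
- exact: fold_bij H.
- split=> [d /= d1|d d' _ _ /phi_inj //|_ [f fe0] <-].
    have [[f fe0 fd]|[f fd]] := fold_block H d; last by rewrite fd bs in d1.
    exists f => //; apply: walk_inj; last exact: esym fd.
    rewrite [RHS](_ : _ = fv (fsrc d)) //.
    by have := fold_src H d; rewrite fd /= => /andP[/eqP].
  have [d fd] := fold_single H fe0.
  exists d; first by rewrite /= fd.
  apply: walk_inj; last exact: fd.
  rewrite [LHS](_ : _ = fv (fsrc d)) //.
  by have := fold_src H d; rewrite fd /= => /andP[/eqP].
- split=> [d /= d1|d d' _ _ /phi_inj //|p [p2 pe]].
    have [[f fe0 fd]|[f fd]] := fold_block H d; first by rewrite fd in d1.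
    have pe : wedges (hE phi d : walk D2) = block k e f by exact: fd.
    by rewrite /wlen pe bs; split=> //; rewrite /block; case: (k).
  have [f pf] : exists f, wedges p = block k e f.
    move: p2 pe; rewrite /wlen /block; case: (wedges p) => [|a [|b [|]]] //= _.
    by case: (k) => -[->]; [exists a|exists b].
  have pw := svalP p; rewrite -/(wedges p) pf in pw.
  have [d fd] := fold_pair H (block_walk pw).
  exists d; first by rewrite /= fd bs.
  apply: walk_inj; last by rewrite pf; exact: fd.
  rewrite [LHS](_ : _ = fv (fsrc d)) //.
  have := fold_src H d; move: pw; rewrite fd /block /wstart.
  by case: (k) => /= /and3P[/eqP <- _ _] /and3P[/eqP].
Qed.

Lemma add1_elementary (D1 D2 : finDigraph) : is_add1 D1 D2 ->
  exists2 phi : hom D1 (Walks D2), folding phi & elementary1 phi.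
Proof.
move=> [gv [ge [gvi gei gst [v vn vall]]]].
have gesur f : exists d, ge d = f by case: gei => h _ hK; exists (h f).
pose g : hom D1 D2 :=
  @Hom D1 D2 gv ge (fun d => (gst d).1) (fun d => (gst d).2).
pose phi := hom_comp g (walk_incl D2).
have rd (y : biwalk D2) i d : ge d = ed y i -> reads y i (hE phi d : walk D2).
  by move=> gd -[|[]] //= _; rewrite addr0 -gd.
exists phi.
  apply: (@folding_of_cuts _ _ phi (fun _ _ => True)) => //.
  - move=> d d' /(congr1 (fun p : walk D2 => wedges p)) [].
    exact: (bij_inj gei).
  - by move=> d [].
  - by move=> y; exists 0.
  - by move=> y i _; have [d gd] := gesur (ed y i); exists d => //; exact: rd.
  - move=> y i _; have [d gd] := gesur (ed y (i - 1)).
    by exists d => //; exact: rd.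
exists g; split=> //; first exact: (bij_inj gei).
exists v; split.
- by move=> [u _ /vn].
- by move=> u; have [->|[u' <-]] := vall u; [right|left; exists u'].
- by move=> f; have [d <-] := gesur f; exists d.
- move=> f; have [d <-] := gesur f; have [-> ->] := gst d.
  by split; exact: vn.
Qed.

(** The equivalence relation is generated on all finite digraphs, so that the
    combinatorial constructions need not check the UDAF condition at each step;
    it propagates along the relation afterwards. *)
Inductive flow : finDigraph -> finDigraph -> Prop :=
| flow_add1 D1 D2 : is_add1 D1 D2 -> flow D1 D2
| flow_fold k D1 D2 : is_fold k D1 D2 -> flow D1 D2
| flow_refl D : flow D D
| flow_sym D1 D2 : flow D1 D2 -> flow D2 D1
| flow_trans D2 D1 D3 : flow D1 D2 -> flow D2 D3 -> flow D1 D3.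

(** * The UDAF condition *)

Definition op (D : finDigraph) : finDigraph := FinDigraph (@ftgt D) (@fsrc D).

Definition fwalk (D : finDigraph) (v : fV D) (x : nat -> fE D) : Prop :=
  fsrc (x 0%N) = v /\ forall i, ftgt (x i) = fsrc (x i.+1).

Lemma uniq_transfer (A B : Type) (P : A -> Prop) (Q : B -> Prop) (f : A -> B) :
  (forall a, P a -> Q (f a)) -> (forall b, Q b -> exists2 a, P a & f a = b) ->
  (forall a a', f a = f a' -> a = a') ->
  (exists! a, P a) <-> (exists! b, Q b).
Proof.
move=> PQ QP fi; split=> [[a [Pa au]]|[b [Qb bu]]].
  exists (f a); split=> [|b /QP[a' Pa' <-]]; first exact: PQ.
  by rewrite (au _ Pa').
have [a Pa fa] := QP _ Qb; exists a; split=> // a' Pa'.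
by apply: fi; rewrite fa; apply: bu; exact: PQ.
Qed.

Lemma fwd_in (i : nat) : i%:Z \in `[0, +oo[.
Proof. by rewrite in_itv. Qed.

Lemma fwd_edge_in (i : nat) : (i%:Z \in `[0, +oo[) && (i%:Z + 1 \in `[0, +oo[).
Proof. by rewrite -PoszD !fwd_in. Qed.

Lemma bwd_in (i : nat) : - i%:Z \in `]-oo, 0].
Proof. by rewrite in_itv /=; zlia. Qed.

Lemma bwd_edge_in (i : nat) :
  (- i.+1%:Z \in `]-oo, 0]) && (- i.+1%:Z + 1 \in `]-oo, 0]).
Proof. by rewrite !in_itv /=; zlia. Qed.

Definition fwd_edge (i : nat) : dE (Zint `[0, +oo[) := exist _ i%:Z (fwd_edge_in i).
Definition fwd_vertex (i : nat) : dV (Zint `[0, +oo[) := exist _ i%:Z (fwd_in i).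
Definition bwd_edge (i : nat) : dE (Zint `]-oo, 0]) :=
  exist _ (- i.+1%:Z) (bwd_edge_in i).
Definition bwd_vertex (i : nat) : dV (Zint `]-oo, 0]) := exist _ (- i%:Z) (bwd_in i).

Lemma fwd_uniq (D : finDigraph) (v : fV D) :
  (exists! h : hom (Zint `[0, +oo[) D, hV h (exist _ 0 isT) = v) <->
  (exists! x, fwalk v x).
Proof.
have hs (h : hom (Zint `[0, +oo[) D) i :
    fsrc (hE h (fwd_edge i) : fE D) = hV h (fwd_vertex i).
  by have /= -> := hsrc h (fwd_edge i); congr (hV h _); exact: val_inj.
have ht (h : hom (Zint `[0, +oo[) D) i :
    ftgt (hE h (fwd_edge i) : fE D) = hV h (fwd_vertex i.+1).
  have /= -> := htgt h (fwd_edge i); congr (hV h _); apply: val_inj => /=; zlia.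
have vE (u : dV (Zint `[0, +oo[)) : u = fwd_vertex (absz (sval u)).
  apply: val_inj => /=; have := svalP u; rewrite in_itv /=; zlia.
have eE (e : dE (Zint `[0, +oo[)) : e = fwd_edge (absz (sval e)).
  apply: val_inj => /=; have /andP[] := svalP e; rewrite !in_itv /=; zlia.
apply: (@uniq_transfer (hom (Zint `[0, +oo[) D) (nat -> fE D) _ _
  (fun h i => hE h (fwd_edge i))).
- move=> h hv; split=> [|i]; last by rewrite hs ht.
  by rewrite hs -hv; congr (hV h _); exact: val_inj.
- move=> x [xv xS].
  have s (e : dE (Zint `[0, +oo[)) :
     dsrc (x (absz (sval e)) : dE D) = fsrc (x (absz (sval (dsrc e)))) by [].
  have t (e : dE (Zint `[0, +oo[)) :
     dtgt (x (absz (sval e)) : dE D) = fsrc (x (absz (sval (dtgt e)))).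
    rewrite (eE e) /= xS; congr (fsrc (x _)); zlia.
  by exists (@Hom (Zint `[0, +oo[) D (fun u => fsrc (x (absz (sval u))))
    (fun e => x (absz (sval e))) s t).
- move=> h h' hh; have {}hh i : hE h (fwd_edge i) = hE h' (fwd_edge i).
    exact: (congr1 (fun f => f i) hh).
  by apply: homP => [u|e]; [rewrite (vE u) -!hs hh|rewrite (eE e) hh].
Qed.

Lemma bwd_uniq (D : finDigraph) (v : fV D) :
  (exists! h : hom (Zint `]-oo, 0]) D, hV h (exist _ 0 isT) = v) <->
  (exists! x, @fwalk (op D) v x).
Proof.
have hs (h : hom (Zint `]-oo, 0]) D) i :
    fsrc (hE h (bwd_edge i) : fE D) = hV h (bwd_vertex i.+1).
  by have /= -> := hsrc h (bwd_edge i); congr (hV h _); exact: val_inj.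
have ht (h : hom (Zint `]-oo, 0]) D) i :
    ftgt (hE h (bwd_edge i) : fE D) = hV h (bwd_vertex i).
  have /= -> := htgt h (bwd_edge i); congr (hV h _); apply: val_inj => /=; zlia.
have vE (u : dV (Zint `]-oo, 0])) : u = bwd_vertex (absz (sval u)).
  apply: val_inj => /=; have := svalP u; rewrite in_itv /=; zlia.
have eE (e : dE (Zint `]-oo, 0])) : e = bwd_edge (absz (sval e)).-1.
  apply: val_inj => /=; have /andP[] := svalP e; rewrite !in_itv /=; zlia.
apply: (@uniq_transfer (hom (Zint `]-oo, 0]) D) (nat -> fE D) _ _
  (fun h i => hE h (bwd_edge i))).
- move=> h hv; split=> [|i]; last by rewrite /= hs ht.
  by rewrite /= ht -hv; congr (hV h _); exact: val_inj.
- move=> x [xv xS].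
  have s (e : dE (Zint `]-oo, 0])) :
     dsrc (x (absz (sval e)).-1 : dE D) = ftgt (x (absz (sval (dsrc e)))).
    rewrite (eE e) /=; have /= -> := xS (absz (sval e)).-1.
    by congr (ftgt (x _)); zlia.
  have t (e : dE (Zint `]-oo, 0])) :
     dtgt (x (absz (sval e)).-1 : dE D) = ftgt (x (absz (sval (dtgt e)))).
    by rewrite (eE e) /=; congr (ftgt (x _)); zlia.
  exists (@Hom (Zint `]-oo, 0]) D (fun u => ftgt (x (absz (sval u))))
    (fun e => x (absz (sval e)).-1) s t) => //.
- move=> h h' hh; have {}hh i : hE h (bwd_edge i) = hE h' (bwd_edge i).
    exact: (congr1 (fun f => f i) hh).
  by apply: homP => [u|e]; [rewrite (vE u) -!ht hh|rewrite (eE e) hh].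
Qed.

(** Being the source of an infinite forward walk, stated coinductively so that
    it can be transported without building walks. *)
Definition live (D : finDigraph) (v : fV D) : Prop :=
  exists2 L : fV D -> Prop, L v &
    forall u, L u -> exists e, fsrc e = u /\ L (ftgt e).

(** On W exactly one edge leads to a vertex with an infinite forward walk, and it
    ends in W; so the infinite walk from a vertex of W is forced. Conversely the
    vertices with exactly one infinite forward walk form such a set. *)
Definition lone (D : finDigraph) : Prop :=
  exists2 W : fV D -> Prop, (exists v, W v) &
    forall u, W u -> exists e, [/\ fsrc e = u, W (ftgt e) &
      forall e', fsrc e' = u -> live (ftgt e') -> e' = e].

Lemma fwalk_tail (D : finDigraph) (v : fV D) x :
  fwalk v x -> fwalk (ftgt (x 0%N)) (fun i => x i.+1).
Proof. by move=> [_ xS]; split=> [|i]; rewrite xS. Qed.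

Lemma fwalk_cons (D : finDigraph) (e : fE D) x :
  fwalk (ftgt e) x -> fwalk (fsrc e) (fun i => if i is j.+1 then x j else e).
Proof. by move=> [x0 xS]; split=> // -[|i]. Qed.

Lemma fwalk_live (D : finDigraph) (v : fV D) : live v <-> exists x, fwalk v x.
Proof.
split=> [[L Lv Ls]|[x xv]]; last first.
  exists (fun u => exists y, fwalk u y); first by exists x.
  move=> u [y yu]; exists (y 0%N); split; first by case: yu.
  by exists (fun i => y i.+1); exact: fwalk_tail yu.
have [e0 _] := Ls v Lv.
have /choice[nx nxP] u : exists e, L u -> fsrc e = u /\ L (ftgt e).
  have [/Ls[e]|] := pselect (L u); first by exists e.
  by exists e0.
pose s := fix s i := if i is j.+1 then ftgt (nx (s j)) else v.
have Lx i : L (s i) by elim: i => //= i /nxP[].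
exists (fun i => nx (s i)); split; first by have [] := nxP v Lv.
by move=> i; have [-> _] := nxP _ (Lx i.+1).
Qed.

Lemma loneP (D : finDigraph) : lone D <-> exists v : fV D, exists! x, fwalk v x.
Proof.
split=> [[W [v Wv] Ws]|[v [x [xv xu]]]]; last first.
  exists (fun u => exists! y, fwalk u y); first by exists v, x.
  move=> u [y [yu yuniq]]; exists (y 0%N); split.
  - by case: yu.
  - exists (fun i => y i.+1); split=> [|z]; first exact: fwalk_tail yu.
    move=> /fwalk_cons; have [y0 _] := yu; rewrite y0 => /yuniq -> //.
  - move=> e' e'u /fwalk_live[z /fwalk_cons]; rewrite e'u => /yuniq.
    by move=> ->.
have /fwalk_live[x xv] : live v.
  by exists W => // u /Ws[e [eu We _]]; exists e.
exists v, x; split=> // y yv.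
suff H : forall i, W (fsrc (x i)) /\ x i = y i.
  by apply/funext => j; have [] := H j.
have step i : W (fsrc (x i)) -> fsrc (x i) = fsrc (y i) ->
    W (ftgt (x i)) /\ x i = y i.
  move=> /Ws[e [es We eu]] xy.
  have lx z w j : @fwalk D w z -> live (ftgt (z j)).
    move=> [_ zS]; apply/fwalk_live; exists (fun i => z (j + i.+1)%N).
    by split=> [|k] /=; rewrite ?addn1 zS // !addnS.
  have -> : x i = e by apply: eu => //; exact: lx xv.
  by have -> : y i = e by apply: eu; [rewrite -xy|exact: lx yv].
elim=> [|i [Wi xyi]].
  have [x0 _] := xv; have [y0 _] := yv.
  have Wx : W (fsrc (x 0%N)) by rewrite x0.
  by split=> //; have [|_ ->] := step 0%N Wx; first by rewrite x0 y0.
have [_ xS] := xv; have [_ yS] := yv.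
have [] := step i Wi; first by rewrite xyi.
rewrite xS => Wx _; split=> //.
by have [|_ ->] := step i.+1 Wx; first by rewrite -xS -yS xyi.
Qed.

Lemma UDAF_lone (D : finDigraph) : UDAF D <-> ~ lone D /\ ~ lone (op D).
Proof.
split=> [U|[nf nb] v].
  split=> /loneP[v]; have [nf nb] := U v; first by move/fwd_uniq.
  by move/bwd_uniq.
split=> [/fwd_uniq h|/bwd_uniq h]; first by apply: nf; apply/loneP; exists v.
by apply: nb; apply/loneP; exists v.
Qed.

(** * The UDAF condition along elementary moves *)

Lemma live_next (D : finDigraph) (v : fV D) :
  live v <-> exists e, fsrc e = v /\ live (ftgt e).
Proof.
split=> [[L Lv Ls]|[e [ev [L Le Ls]]]].
  by have [e [ev Le]] := Ls v Lv; exists e; split=> //; exists L.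
exists (fun u => L u \/ u = v); first by right.
move=> u [/Ls[e' [eu Le']]|->]; last by exists e; split=> //; left.
by exists e'; split=> //; left.
Qed.

Lemma lone_live (D : finDigraph) (W : fV D -> Prop) :
  (forall u, W u -> exists e, [/\ fsrc e = u, W (ftgt e) &
     forall e', fsrc e' = u -> live (ftgt e') -> e' = e]) ->
  forall u, W u -> live u.
Proof. by move=> Ws u Wu; exists W => // x /Ws[e [ex We _]]; exists e. Qed.

(** Additional vertices are isolated, so no infinite walk starts there. *)
Lemma lone_embed (D1 D2 : finDigraph)
    (gv : fV D1 -> fV D2) (ge : fE D1 -> fE D2) :
  injective gv -> bijective ge ->
  (forall d, fsrc (ge d) = gv (fsrc d) /\ ftgt (ge d) = gv (ftgt d)) ->
  lone D1 <-> lone D2.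
Proof.
move=> gvi gei gst.
have gesur f : exists d, ge d = f by case: gei => h _ hK; exists (h f).
have gs d := (gst d).1; have gt d := (gst d).2.
have livE v : live (gv v) <-> live v.
  split=> [[L Lv Ls]|[L Lv Ls]].
    exists (fun u => L (gv u)) => // u /Ls[f [fu Lf]].
    have [d df] := gesur f; exists d; move: fu Lf; rewrite -df gs gt.
    by move=> /gvi.
  exists (fun u => exists2 x, gv x = u & L x); first by exists v.
  move=> _ [x <- /Ls[d [dx Ld]]]; exists (ge d).
  by rewrite gs gt dx; split=> //; exists (ftgt d).
split=> [[W [v Wv] Ws]|[W [v Wv] Ws]].
  exists (fun u => exists2 x, gv x = u & W x); first by exists (gv v), v.
  move=> _ [x <- /Ws[d [dx Wd du]]]; exists (ge d).
  rewrite gs gt dx; split=> //; first by exists (ftgt d).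
  move=> f; have [d' <-] := gesur f; rewrite gs gt => /gvi d'x /livE ld.
  by rewrite (du d').
exists (fun u => W (gv u)).
  have [f [fv Wf _]] := Ws v Wv; have [d df] := gesur f.
  by exists (fsrc d); rewrite -gs df fv.
move=> u /Ws[f [fu Wf funi]]; have [d df] := gesur f.
exists d; split.
- by apply: gvi; rewrite -gs df.
- by rewrite -gt df.
- move=> d' d'u ld; apply: (bij_inj gei); rewrite df; apply: funi.
    by rewrite gs d'u.
  by rewrite gt; apply/livE.
Qed.

Section FoldLone.
Variables (D2 : finDigraph) (E1 : finType) (s t : E1 -> fV D2).
Notation D1 := (FinDigraph s t).
Variables (k : bool) (e : fE D2) (fe : E1 -> seq (fE D2)).
Hypothesis H : @fold_at k D1 D2 e id fe.

Lemma fold_src1 d f l : fe d = f :: l -> s d = fsrc f.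
Proof. by move=> fd; have := fold_src H d; rewrite fd /= => /andP[/eqP]. Qed.

Lemma fold_tgt1 d l f : fe d = rcons l f -> t d = ftgt f.
Proof.
by move=> fd; have /= := fold_tgt H d; rewrite fd map_rcons last_rcons => <-.
Qed.

Lemma fold_single1 f : f <> e ->
  exists d, [/\ fe d = [:: f], s d = fsrc f & t d = ftgt f].
Proof.
move=> /(fold_single H)[d fd]; exists d; split=> //.
  exact: fold_src1 fd.
exact: (@fold_tgt1 d [::] f fd).
Qed.

End FoldLone.

(** Edge foldings that merge e with the edge after it: the infinite forward walks
    from each vertex are the same in D1 and D2, up to this merging. *)
Section FoldLoneF.
Variables (D2 : finDigraph) (E1 : finType) (s t : E1 -> fV D2).
Notation D1 := (FinDigraph s t).
Variables (e : fE D2) (fe : E1 -> seq (fE D2)).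
Hypothesis H : @fold_at false D1 D2 e id fe.

Lemma foldF_edge d :
  (exists f, [/\ fe d = [:: f], f <> e, s d = fsrc f & t d = ftgt f]) \/
  (exists f, [/\ fe d = [:: e; f], s d = fsrc e, fsrc f = ftgt e & t d = ftgt f]).
Proof.
have [[f fe0 fd]|[f fd]] := fold_block H d; [left|right]; exists f; split=> //.
- exact: (fold_src1 H fd).
- exact: (@fold_tgt1 _ _ _ _ _ _ _ H d [::] f fd).
- exact: (fold_src1 H fd).
- by have := fold_src H d; rewrite fd => /block_walk.
- exact: (@fold_tgt1 _ _ _ _ _ _ _ H d [:: e] f fd).
Qed.

Lemma foldF_pair f : fsrc f = ftgt e ->
  exists d, [/\ fe d = [:: e; f], s d = fsrc e & t d = ftgt f].
Proof.
move=> /esym /(fold_pair H)[d fd]; exists d; split=> //.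
  exact: (fold_src1 H fd).
exact: (@fold_tgt1 _ _ _ _ _ _ _ H d [:: e] f fd).
Qed.

Lemma foldF_live v : @live D1 v <-> @live D2 v.
Proof.
split=> [[L Lv Ls]|[L Lv Ls]].
  exists (fun u => L u \/
    (u = ftgt e /\ exists f : fE D2, fsrc f = u /\ L (ftgt f))).
    by left.
  move=> u [/Ls[d /= [du Ld]]|[-> [f [fu Lf]]]]; last by exists f; split=> //; left.
  have [[f [_ _ sf tf]]|[f [_ sf fs tf]]] := foldF_edge d.
    by exists f; rewrite -sf -tf; split=> //; left.
  exists e; rewrite -sf; split=> //; right; split=> //; exists f.
  by rewrite -tf.
exists L => // u /Ls[f [fu Lf]].
have [fe0|fe0] := pselect (f = e); last first.
  by have [d [_ sd td]] := fold_single1 H fe0; exists d; rewrite /= sd td.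
rewrite fe0 in fu Lf; have [g [gs Lg]] := Ls _ Lf.
by have [d [_ sd td]] := foldF_pair gs; exists d; rewrite /= sd td.
Qed.

(** From D1 to D2 the target of e has to join the set W when the forced edge at
    the source of e is a merged one. *)
Lemma foldF_lone : lone D1 <-> lone D2.
Proof.
split=> [[W [v Wv] Ws]|[W [v Wv] Ws]].
- exists (fun u => W u \/ exists f : fE D2, [/\ fsrc f = u, u = ftgt e, W (ftgt f) &
    forall f' : fE D2, fsrc f' = u -> @live D2 (ftgt f') -> f' = f]).
    by exists v; left.
  move=> u [/Ws[d /= [du Wd dun]]|[f [fu _ Wf fun_]]]; last first.
    by exists f; split=> //; left.
  have [[f [fd fne sf tf]]|[f [fd sf fs tf]]] := foldF_edge d.
    exists f; split; [by rewrite -sf|by left; rewrite -tf|].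
    move=> f' f'u lf'; have [fe0|fe0] := pselect (f' = e); last first.
      have [d' [fd' sd' td']] := fold_single1 H fe0.
      have dd : d' = d by apply: dun; rewrite ?sd' // td'; apply/foldF_live.
      by move: fd'; rewrite dd fd => -[].
    rewrite fe0 in f'u lf'; have /live_next[g [gs lg]] := lf'.
    have [d' [fd' sd' td']] := foldF_pair gs.
    have dd : d' = d by apply: dun; rewrite ?sd' // td'; apply/foldF_live.
    by move: fd'; rewrite dd fd.
  exists e; split; [by rewrite -sf| |].
    right; exists f; split=> //; first by rewrite -tf.
    move=> f' f's lf'; have [d' [fd' sd' td']] := foldF_pair f's.
    have dd : d' = d by apply: dun; rewrite ?sd' -?sf // td'; apply/foldF_live.
    by move: fd'; rewrite dd fd => -[].
  move=> f' f'u lf'; apply: contrapT => fe0.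
  have [d' [fd' sd' td']] := fold_single1 H fe0.
  have dd : d' = d by apply: dun; rewrite ?sd' // td'; apply/foldF_live.
  by move: fd'; rewrite dd fd.
- exists W; first by exists v.
  move=> u /Ws[f [fu Wf fun_]]; have [fe0|fe0] := pselect (f = e); last first.
    have [d [fd sd td]] := fold_single1 H fe0; exists d.
    rewrite /= sd td; split=> // d' /= d'u /foldF_live ld'.
    have [[f' [fd' fne sf tf]]|[f' [fd' sf fs tf]]] := foldF_edge d'.
      apply: (fold_inj H); rewrite fd fd'; congr [:: _].
      by apply: fun_; [rewrite -sf|rewrite -tf].
    case: fe0; apply/esym/fun_; first by rewrite -sf.
    by apply/live_next; exists f'; rewrite -tf.
  rewrite fe0 in fu Wf; have [g [gs Wg gu]] := Ws _ Wf.
  have [d [fd sd td]] := foldF_pair gs; exists d.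
  rewrite /= sd td; split=> // d' /= d'u /foldF_live ld'.
  apply: (fold_inj H); rewrite fd.
  have [[f' [fd' fne sf tf]]|[f' [fd' sf fs tf]]] := foldF_edge d'.
    case: fne; rewrite -fe0; apply: fun_; first by rewrite -sf.
    by rewrite -tf.
  by rewrite fd'; congr [:: _; _]; apply: gu; rewrite -?tf.
Qed.

End FoldLoneF.

(** Edge foldings that merge e with the edge before it: the walks of D2 that
    start with e are lost in D1. Vertices other than the source of e keep their
    infinite walks; the source keeps those that do not start with e. *)
Section FoldLoneT.
Variables (D2 : finDigraph) (E1 : finType) (s t : E1 -> fV D2).
Notation D1 := (FinDigraph s t).
Variables (e : fE D2) (fe : E1 -> seq (fE D2)).
Hypothesis H : @fold_at true D1 D2 e id fe.
Notation u0 := (fsrc e).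
Notation w := (ftgt e).

Lemma foldT_edge d :
  (exists f, [/\ fe d = [:: f], f <> e, s d = fsrc f & t d = ftgt f]) \/
  (exists f, [/\ fe d = [:: f; e], s d = fsrc f, ftgt f = u0 & t d = w]).
Proof.
have [[f fe0 fd]|[f fd]] := fold_block H d; [left|right]; exists f; split=> //.
- exact: (fold_src1 H fd).
- exact: (@fold_tgt1 _ _ _ _ _ _ _ H d [::] f fd).
- exact: (fold_src1 H fd).
- by have := fold_src H d; rewrite fd => /block_walk.
- exact: (@fold_tgt1 _ _ _ _ _ _ _ H d [:: f] e fd).
Qed.

Lemma foldT_pair f : ftgt f = u0 ->
  exists d, [/\ fe d = [:: f; e], s d = fsrc f & t d = w].
Proof.
move=> /(fold_pair H)[d fd]; exists d; split=> //.
  exact: (fold_src1 H fd).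
exact: (@fold_tgt1 _ _ _ _ _ _ _ H d [:: f] e fd).
Qed.

Lemma foldT_nloop : w <> u0.
Proof. by move=> /esym; exact: fold_nloop H. Qed.

Lemma foldT_live12 v : @live D1 v -> @live D2 v.
Proof.
move=> [L Lv Ls]; exists (fun u => L u \/ (u = u0 /\ L w)); first by left.
move=> u [/Ls[d /= [du Ld]]|[-> Lw]]; last by exists e; split=> //; left.
have [[f [_ _ sf tf]]|[f [_ sf ft tf]]] := foldT_edge d.
  by exists f; rewrite -sf -tf; split=> //; left.
by exists f; rewrite -sf ft; split=> //; right; rewrite -tf.
Qed.

Lemma foldT_live21 v : v <> u0 -> @live D2 v -> @live D1 v.
Proof.
move=> vu [L Lv Ls].
exists (fun u => L u /\ (u = u0 -> exists f, [/\ fsrc f = u0, f <> e & L (ftgt f)])).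
  by split.
move=> u [Lu uP].
have [f [fs fe0 Lf]] : exists f : fE D2, [/\ fsrc f = u, f <> e & L (ftgt f)].
  have [/[dup] uu /uP|uu] := pselect (u = u0); first by rewrite uu.
  have [f [fu Lf]] := Ls u Lu; exists f; split=> // fe0.
  by apply: uu; rewrite -fu fe0.
have [fu0|fu0] := pselect (ftgt f = u0); last first.
  have [d [_ sd td]] := fold_single1 H fe0; exists d; rewrite /= sd td.
  by split=> //; split.
have [g [gs Lg]] := Ls _ Lf; have [ge|ge] := pselect (g = e); last first.
  have [d [_ sd td]] := fold_single1 H fe0; exists d; rewrite /= sd td.
  by split=> //; split=> // _; exists g; rewrite gs.
rewrite ge in Lg; have [d [_ sd td]] := foldT_pair fu0.
exists d; rewrite /= sd td; split=> //; split=> // /foldT_nloop; exact.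
Qed.

Lemma foldT_live_src f : f <> e -> fsrc f = u0 -> @live D2 (ftgt f) -> @live D1 u0.
Proof.
move=> fe0 fs lf; have [d [_ sd td]] := fold_single1 H fe0.
have [fu|fu] := pselect (ftgt f = u0).
  exists (fun u => u = u0) => // u ->; exists d.
  by rewrite /= sd td.
apply/live_next; exists d; rewrite /= sd td; split=> //.
exact: foldT_live21.
Qed.

(** If no infinite walk starts at w, the edge e and all merged edges are dead and
    W can be kept. Otherwise W loses u0: if u0 is in W its forced edge is e, and
    the forced edges into u0 become merged edges into w. *)
Lemma foldT_lone21 : lone D2 -> lone D1.
Proof.
move=> [W [v Wv] Ws]; have Wl := lone_live Ws.
have [lw|lw] := pselect (@live D2 w); last first.
  exists W; first by exists v.
  move=> u /Ws[f [fu Wf fun_]].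
  have fe0 : f <> e by move=> fe0; apply: lw; rewrite -fe0; exact: Wl.
  have [d [fd sd td]] := fold_single1 H fe0; exists d; rewrite /= sd td.
  split=> // d' /= d'u /foldT_live12 ld.
  apply: (fold_inj H); rewrite fd.
  have [[f' [fd' fne sf tf]]|[f' [fd' sf ft tf]]] := foldT_edge d'.
    by rewrite fd'; congr [:: _]; apply: fun_; rewrite -?sf -?tf.
  by rewrite tf in ld.
have lu0 : @live D2 u0 by apply/live_next; exists e.
have Wu0 : W u0 -> W w /\ forall f, fsrc f = u0 -> live (ftgt f) -> f = e.
  move=> /Ws[f [fu Wf fun_]]; have ef := fun_ e erefl lw.
  by rewrite -ef in Wf fun_; split.
exists (fun u => W u /\ u <> u0).
  have [vu|vu] := pselect (v = u0); last by exists v.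
  rewrite vu in Wv; have [Ww _] := Wu0 Wv.
  by exists w; split=> //; exact: foldT_nloop.
move=> u [/Ws[f [fu Wf fun_]] uu].
have fe0 : f <> e by move=> fe0; apply: uu; rewrite -fu fe0.
have [fu0|fu0] := pselect (ftgt f = u0); last first.
  have [d [fd sd td]] := fold_single1 H fe0; exists d; rewrite /= sd td.
  split=> // d' /= d'u /foldT_live12 ld.
  apply: (fold_inj H); rewrite fd.
  have [[f' [fd' fne sf tf]]|[f' [fd' sf ft tf]]] := foldT_edge d'.
    by rewrite fd'; congr [:: _]; apply: fun_; rewrite -?sf -?tf.
  have ff : f' = f by apply: fun_; rewrite -?sf // ft.
  by case: fu0; rewrite -ff.
have [d [fd sd td]] := foldT_pair fu0; exists d; rewrite /= sd td.
rewrite fu0 in Wf; have [Ww eu] := Wu0 Wf.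
split=> [//||d' /= d'u ld]; first by split=> //; exact: foldT_nloop.
apply: (fold_inj H); rewrite fd.
have [[f' [fd' fne sf tf]]|[f' [fd' sf ft tf]]] := foldT_edge d'; last first.
  rewrite fd'; congr [:: _; _]; apply: fun_; rewrite -?sf // ft.
  exact: lu0.
have ff : f' = f by apply: fun_; rewrite -?sf // -tf; exact: foldT_live12.
move: ld; rewrite tf ff fu0 => /live_next[d2 /= [d2s]].
have [[g [_ gne sg tg]]|[g [_ sg gt tg]]] := foldT_edge d2.
  rewrite tg => /foldT_live12 lg; case: gne; apply: eu => //.
  by rewrite -sg.
move=> _; have ge : g = e by apply: eu; rewrite -?sg // gt.
by case: foldT_nloop; rewrite -gt ge.
Qed.

(** If no infinite walk starts at w, W can be kept. Otherwise suppose first that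
    u0 still has an infinite walk in D1. Then each edge into u0 has a live
    parallel merged edge into w, so no forced edge enters u0 and W can lose u0.
    If u0 has none, e is its only live edge in D2; the merged edges of D1 are
    undone, and u0 joins W when w is in W. *)
Lemma foldT_lone12 : lone D1 -> lone D2.
Proof.
move=> [W [v Wv] Ws]; have Wl := lone_live Ws.
have [lw|lw] := pselect (@live D2 w); last first.
  exists W; first by exists v.
  move=> u /Ws[d /= [du Wd dun]].
  have [[f [fd fne sf tf]]|[f [fd sf ft tf]]] := foldT_edge d; last first.
    by case: lw; apply: foldT_live12; rewrite -tf; exact: Wl.
  exists f; rewrite -sf -tf; split=> // f' f's lf'.
  have fe0 : f' <> e by move=> fe0; apply: lw; rewrite -fe0.
  have [d' [fd' sd' td']] := fold_single1 H fe0.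
  have dd : d' = d.
    apply: dun; first by rewrite /= sd' f's.
    rewrite /= td'; have [fu|fu] := pselect (ftgt f' = u0); last exact: foldT_live21.
    rewrite fu in lf' *; have /live_next[g [gs lg]] := lf'.
    apply: (@foldT_live_src g) => // ge; apply: lw; by rewrite -ge.
  by move: fd'; rewrite dd fd => -[].
have lw1 : @live D1 w by apply: foldT_live21 lw; exact: foldT_nloop.
have [lu|lu] := pselect (@live D1 u0).
  exists (fun u => W u /\ u <> u0).
    have [vu|vu] := pselect (v = u0); last by exists v.
    have [d /= [du Wd dun]] := Ws v Wv; exists (t d); split=> // tu.
    have [[f [fd fne sf tf]]|[f [fd sf ft tf]]] := foldT_edge d; last first.
      by apply: foldT_nloop; rewrite -tf tu.
    rewrite tf in tu; have [d' [fd' sd' td']] := foldT_pair tu.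
    have dd : d' = d by apply: dun; rewrite ?sd' -?sf // td'.
    by move: fd'; rewrite dd fd.
  move=> u [/Ws[d /= [du Wd dun]] uu].
  have [[f [fd fne sf tf]]|[f [fd sf ft tf]]] := foldT_edge d; last first.
    have fe0 : f <> e by move=> fe0; apply: uu; rewrite -du sf fe0.
    have [d' [fd' sd' td']] := fold_single1 H fe0.
    have dd : d' = d by apply: dun; rewrite ?sd' -?sf // td' ft.
    by move: fd'; rewrite dd fd.
  exists f; rewrite -sf -tf; split=> //.
    split=> // tu; rewrite tf in tu; have [d' [fd' sd' td']] := foldT_pair tu.
    have dd : d' = d by apply: dun; rewrite ?sd' -?sf // td'.
    by move: fd'; rewrite dd fd.
  move=> f' f's lf'.
  have fe0 : f' <> e by move=> fe0; apply: uu; rewrite -f's fe0.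
  have [d' [fd' sd' td']] := fold_single1 H fe0.
  have dd : d' = d.
    apply: dun; first by rewrite sd' f's.
    rewrite td'; have [->//|fu] := pselect (ftgt f' = u0).
    exact: foldT_live21.
  by move: fd'; rewrite dd fd => -[].
have Wu0 u : W u -> u <> u0 by move=> /Wl + uu; rewrite uu.
exists (fun u => W u \/ (u = u0 /\ W w)); first by exists v; left.
move=> u [Wu|[-> Ww]]; last first.
  exists e; split=> //; first by left.
  move=> f fs lf; apply: contrapT => fe0; apply: lu.
  exact: (foldT_live_src fe0).
have uu := Wu0 _ Wu; have [d /= [du Wd dun]] := Ws u Wu.
have ne f : fsrc f = u -> f <> e by move=> fs fe0; apply: uu; rewrite -fs fe0.
have [[f [fd fne sf tf]]|[f [fd sf ft tf]]] := foldT_edge d.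
  exists f; rewrite -sf -tf; split=> //; first by left.
  move=> f' f's lf'; have [fu|fu] := pselect (ftgt f' = u0).
    have [d' [fd' sd' td']] := foldT_pair fu.
    have dd : d' = d by apply: dun; rewrite ?sd' // td'.
    by move: fd'; rewrite dd fd.
  have [d' [fd' sd' td']] := fold_single1 H (ne _ f's).
  have dd : d' = d by apply: dun; rewrite ?sd' // td'; exact: foldT_live21.
  by move: fd'; rewrite dd fd => -[].
exists f; rewrite -sf ft; split=> //; first by right; rewrite -tf.
move=> f' f's lf'; have [fu|fu] := pselect (ftgt f' = u0).
  have [d' [fd' sd' td']] := foldT_pair fu.
  have dd : d' = d by apply: dun; rewrite ?sd' // td'.
  by move: fd'; rewrite dd fd => -[].
have [d' [fd' sd' td']] := fold_single1 H (ne _ f's).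
have dd : d' = d by apply: dun; rewrite ?sd' // td'; exact: foldT_live21.
by move: fd'; rewrite dd fd.
Qed.

End FoldLoneT.

(** * From elementary moves to isomorphisms in the category *)

Lemma rev_walk (D : finDigraph) (v : fV D) s : is_walk v s ->
  @is_walk (op D) (last v (map (@ftgt D) s)) (rev s) /\
  last (last v (map (@ftgt D) s)) (map (@fsrc D) (rev s)) = v.
Proof.
elim: s v => //= d s IH v /andP[/eqP dv /IH[ws ls]].
rewrite rev_cons -cats1 is_walk_cat ws map_cat last_cat /= ls.
by rewrite eqxx dv.
Qed.

Lemma fold_at_op k (D1 D2 : finDigraph) e fv fe : @fold_at k D1 D2 e fv fe ->
  @fold_at (~~ k) (op D1) (op D2) e fv (rev \o fe).
Proof.
move=> H; have rb f : rev (block k e f) = block (~~ k) e f by case: (k).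
split.
- by move=> /= /esym; exact: fold_nloop H.
- exact: fold_bij H.
- by move=> d d' /= /(congr1 rev); rewrite !revK => /(fold_inj H).
- by move=> d; have [w _] := rev_walk (fold_src H d); rewrite /= -(fold_tgt H).
- by move=> d; have [_ l] := rev_walk (fold_src H d); rewrite /= -(fold_tgt H).
- move=> d /=; have [[f fe0 ->]|[f ->]] := fold_block H d; [left|right]; exists f => //.
- by move=> f /(fold_single H)[d fd]; exists d; rewrite /= fd.
- move=> f fP; have [|d fd] := @fold_pair _ _ _ _ _ _ H f.
    by case: (k) fP => /= ->.
  by exists d; rewrite /= fd.
Qed.

Lemma is_fold_op k D1 D2 : is_fold k D1 D2 -> is_fold (~~ k) (op D1) (op D2).
Proof. by move=> [e [fv [fe /fold_at_op H]]]; exists e, fv, (rev \o fe). Qed.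

Lemma is_add1_op D1 D2 : is_add1 D1 D2 -> is_add1 (op D1) (op D2).
Proof.
move=> [gv [ge [gvi gei gst ex]]]; exists gv, ge; split=> // d.
by have [] := gst d.
Qed.

Lemma flow_op D1 D2 : flow D1 D2 -> flow (op D1) (op D2).
Proof.
elim=> {D1 D2}.
- by move=> D1 D2 /is_add1_op; exact: flow_add1.
- by move=> k D1 D2 /is_fold_op; exact: flow_fold.
- by move=> D; exact: flow_refl.
- by move=> D1 D2 _; exact: flow_sym.
- by move=> D2 D1 D3 _ h12 _; exact: flow_trans h12.
Qed.

Lemma is_fold_lone k D1 D2 : is_fold k D1 D2 -> lone D1 <-> lone D2.
Proof.
move=> [e [fv [fe H]]].
pose D1' := FinDigraph (fun d : fE D1 => fv (fsrc d)) (fun d => fv (ftgt d)).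
have -> : lone D1 <-> lone D1'.
  apply: (@lone_embed D1 D1' fv id) => //; first exact/bij_inj/(fold_bij H).
  by exists id.
have H' : @fold_at k D1' D2 e id fe.
  case: H => ? ? ? ? ? ? ? ?; split=> //; by exists id.
case: k H H' => H H'; last exact: foldF_lone H'.
by split; [exact: foldT_lone12 H'|exact: foldT_lone21 H'].
Qed.

Lemma is_add1_lone D1 D2 : is_add1 D1 D2 -> lone D1 <-> lone D2.
Proof. by move=> [gv [ge [gvi gei gst _]]]; exact: lone_embed gst. Qed.

Lemma flow_UDAF D1 D2 : flow D1 D2 -> UDAF D1 <-> UDAF D2.
Proof.
elim=> {D1 D2}.
- move=> D1 D2 h; rewrite !UDAF_lone (is_add1_lone h).
  by rewrite (is_add1_lone (is_add1_op h)).
- move=> k D1 D2 h; rewrite !UDAF_lone (is_fold_lone h).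
  by rewrite (is_fold_lone (is_fold_op h)).
- by [].
- by move=> D1 D2 _ ->.
- by move=> D2 D1 D3 _ -> _ ->.
Qed.

Lemma iso_elementary (D1 D2 : udafDigraph) (phi : hom D1 (Walks D2)) :
  elementary phi -> isomorphic_in UDAFG' D1 D2.
Proof.
move=> el; have [F [pF Fbij]] := el.1.
have [G FG GF] := Fbij; exists F, G; split=> //.
  exact: UDAFG'_elementary el pF.
exact: UDAFG'_elementary_inv el pF FG GF.
Qed.

Lemma flow_iso D1 D2 : flow D1 D2 -> forall (U1 : UDAF D1) (U2 : UDAF D2),
  isomorphic_in UDAFG' (UdafDigraph U1) (UdafDigraph U2).
Proof.
elim=> {D1 D2}.
- move=> D1 D2 /add1_elementary[phi fphi el] U1 U2.
  apply: (@iso_elementary (UdafDigraph U1) (UdafDigraph U2) phi).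
  by split=> //; apply: Or31.
- move=> k D1 D2 [e [fv [fe H]]] U1 U2.
  apply: (@iso_elementary (UdafDigraph U1) (UdafDigraph U2)
    (seq_hom (fold_src H) (fold_tgt H))).
  split; first exact: fold_folding.
  have := fold_edge_folding H; move: (seq_hom _ _) => phi.
  by case: (k) => h; [exact: Or33|exact: Or32].
- move=> D U1 U2; rewrite (Prop_irrelevance U1 U2).
  by exists id, id; split=> //; exact: UDAFG'_id.
- move=> D1 D2 _ IH U2 U1; have [F [G [cF cG FG GF]]] := IH U1 U2.
  by exists G, F.
- move=> D2 D1 D3 h12 IH12 _ IH23 U1 U3.
  have U2 : UDAF D2 := (flow_UDAF h12).1 U1.
  have [F [G [cF cG FG GF]]] := IH12 U1 U2.
  have [F' [G' [cF' cG' FG' GF']]] := IH23 U2 U3.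
  exists (fun R => F' (F R)), (fun R => G (G' R)); split.
  - exact: UDAFG'_comp cF cF'.
  - exact: UDAFG'_comp cG' cG.
  - by move=> R; rewrite FG'.
  - by move=> R; rewrite GF.
Qed.

(** * Combinatorics of the moves *)

(** Both digraphs embed in D2 with an isolated vertex added, with exactly that
    vertex left over. *)
Lemma iso_flow (D1 D2 : finDigraph)
    (gv : fV D1 -> fV D2) (ge : fE D1 -> fE D2) :
  bijective gv -> bijective ge ->
  (forall d, fsrc (ge d) = gv (fsrc d) /\ ftgt (ge d) = gv (ftgt d)) ->
  flow D1 D2.
Proof.
move=> gvb geb gst.
pose D3 := @FinDigraph (option (fV D2)) (fE D2)
  (fun e => Some (fsrc e)) (fun e => Some (ftgt e)).
apply: (@flow_trans D3); last apply: flow_sym; apply: flow_add1.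
  exists (fun v => Some (gv v)), ge; split=> //.
  - by move=> u v [/(bij_inj gvb)].
  - by move=> d; have [sd td] := gst d; rewrite /= sd td.
  - exists None => // -[u|]; [right|by left].
    by have [h _ hK] := gvb; exists (h u); rewrite hK.
exists Some, id; split=> //; first by exists id.
by exists None => // -[u|]; [right; exists u|left].
Qed.

Definition dsub (D : finDigraph) (P : pred (fE D)) : finDigraph :=
  @FinDigraph (fV D) {e : fE D | P e}
    (fun e => fsrc (val e)) (fun e => ftgt (val e)).

Lemma dsubT (D : finDigraph) : flow (dsub (fun _ : fE D => true)) D.
Proof.
apply: (@iso_flow (dsub (fun _ : fE D => true)) D id (fun e => val e)) => //.
  by exists id.
by exists (fun e => exist _ e isT) => // e; exact: val_inj.
Qed.

(** No edge precedes e, so folding e with the edges before it just deletes it. *)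
Lemma dsub_source (D : finDigraph) (P : pred (fE D)) (e : fE D) :
  P e -> (forall f, P f -> ftgt f <> fsrc e) ->
  flow (dsub (fun f => P f && (f != e))) (dsub P).
Proof.
move=> Pe ns; apply: (@flow_fold true).
pose w (d : {f | P f && (f != e)}) : {f | P f} :=
  exist _ (val d) (andP (svalP d)).1.
exists (exist _ e Pe), id, (fun d => [:: w d]); split=> //=.
- by move=> /esym; exact: ns.
- by exists id.
- by move=> d d' [dd]; apply: val_inj.
- by move=> d; rewrite eqxx.
- move=> d; left; exists (w d) => // /(congr1 val) /= de.
  by have /andP[_] := svalP d; rewrite -/(val d) de eqxx.
- move=> [f Pf] fe0; have Pfe : P f && (f != e).
    by rewrite Pf; apply/eqP => fe1; apply: fe0; exact: val_inj.
  by exists (exist _ f Pfe); congr [:: _]; exact: val_inj.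
- by move=> [f Pf] /= /ns.
Qed.

Lemma dsub_sink (D : finDigraph) (P : pred (fE D)) (e : fE D) :
  P e -> (forall f, P f -> fsrc f <> ftgt e) ->
  flow (dsub (fun f => P f && (f != e))) (dsub P).
Proof.
case: D P e => V E s t P e Pe ns.
exact: (flow_op (@dsub_source (FinDigraph t s) P e Pe ns)).
Qed.

(** The hypothesis lets the edges outside P be deleted one at a time, each one
    leaving a source or entering a sink of what is left. *)
Lemma dsub_chain (D : finDigraph) (P Q : pred (fE D)) :
  (forall e, P e -> Q e) ->
  (forall R : pred (fE D), (forall e, P e -> R e) ->
     (exists e, R e && ~~ P e) ->
     exists e, R e && ~~ P e /\ ((forall f, R f -> ftgt f <> fsrc e) \/
                                 (forall f, R f -> fsrc f <> ftgt e))) ->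
  flow (dsub P) (dsub Q).
Proof.
move=> PQ rm; have [n] := ubnP #|[pred e | Q e && ~~ P e]|.
elim: n Q PQ => // n IH Q PQ Qn.
have [[e0 e0P]|nex] := pselect (exists e, Q e && ~~ P e); last first.
  have -> : P = Q; last exact: flow_refl.
  apply/funext => e; apply/idP/idP => [/PQ//|Qe].
  by apply: contrapT => /negP nPe; apply: nex; exists e; rewrite Qe.
have [e [/andP[Qe Pe] eP]] := rm Q PQ (ex_intro _ e0 e0P).
apply: (@flow_trans (dsub (fun f => Q f && (f != e)))); last first.
  by case: eP; [exact: dsub_source|exact: dsub_sink].
apply: IH => [f Pf|].
  by rewrite PQ //=; apply: contraNneq Pe => <-.
apply: leq_trans (_ : #|[pred e | Q e && ~~ P e]| <= n)%N => //.
apply: proper_card; apply/properP; split.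
  by apply/fintype.subsetP => f; rewrite !inE => /andP[/andP[-> _] ->].
by exists e; rewrite !inE ?Qe ?Pe // eqxx andbF.
Qed.

(** The edges of c are to move from v to a new vertex None. [dup_out] gives them
    copies that leave None, and [detour] replaces the originals by one edge from
    v to None; unfolding this edge forwards gives [dup_out] back, unfolding it
    backwards gives None copies of the edges into v. *)
Section OutSplit.
Variables (D : finDigraph) (v : fV D) (c : fE D -> bool).
Hypothesis cv : forall e, c e -> fsrc e = v.

Definition detour : finDigraph :=
  @FinDigraph (option (fV D)) (option (fE D))
    (fun e => if e is Some d then (if c d then None else Some (fsrc d))
              else Some v)
    (fun e => if e is Some d then Some (ftgt d) else None).

Definition dup_out : finDigraph :=
  @FinDigraph (option (fV D)) (fE D + {e : fE D | c e})%type
    (fun e => if e is inl d then Some (fsrc d) else None)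
    (fun e => match e with inl d => Some (ftgt d)
                         | inr d => Some (ftgt (val d)) end).

Lemma dup_out_flow : flow D dup_out.
Proof.
pose P (e : fE dup_out) := if e is inl _ then true else false.
apply: (@flow_trans (dsub P)).
  apply: flow_add1; exists Some, (fun e => exist (fun d => P d) (inl e) isT).
  split=> //.
  - exists (fun d : {d | P d} =>
        match val d with inl e => e | inr e => val e end) => //.
    by move=> [[e|e] //= Pe]; exact: val_inj.
  - by exists None => // -[u|]; [right; exists u|left].
apply: (@flow_trans (dsub (fun _ => true)) _ _ _ (dsubT _)).
apply: dsub_chain => // R _ [[e|e]]; first by rewrite andbF.
by exists (inr e); split=> //; left => -[f|f] _.
Qed.

Lemma detour_flow : flow dup_out detour.
Proof.
apply: (@flow_fold false).
exists None, id, (fun d => match d with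
  | inl e => if c e then [:: None; Some e] else [:: Some e]
  | inr e => [:: Some (val e)] end); split=> //=.
- by exists id.
- move=> [e|e] [e'|e'] /=; repeat case: ifP => //.
  + by move=> _ _ [->].
  + by move=> _ _ [->].
  + by move=> ce [ee]; rewrite ee (svalP e') in ce.
  + by move=> ce [ee]; rewrite -ee (svalP e) in ce.
  + by move=> [ee]; congr inr; exact: val_inj.
- move=> [e|e] /=; last by rewrite (svalP e).
  by case: ifP => ce /=; rewrite ce ?eqxx ?(cv ce) ?eqxx.
- by move=> [e|e] //=; case: ifP.
- move=> [e|e]; last by left; exists (Some (val e)).
  by case: ifP => _; [right; exists (Some e)|left; exists (Some e)].
- move=> [e|] // _; have [ce|ce] := boolP (c e).
    by exists (inr (exist _ e ce)).
  by exists (inl e); rewrite (negbTE ce).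
- by move=> [e|] //; case: ifP => // ce _; exists (inl e); rewrite ce.
Qed.

Variables (E' : finType) (s' t' : E' -> option (fV D)) (pe : E' -> fE D).
Hypothesis s'E : forall d, s' d = if c (pe d) then None else Some (fsrc (pe d)).
Hypothesis t'E : forall d, odflt v (t' d) = ftgt (pe d).
Hypothesis pe_inj : forall d d', pe d = pe d' -> t' d = t' d' -> d = d'.
Hypothesis pe_surj : forall e g, odflt v g = ftgt e ->
  exists2 d, pe d = e & t' d = g.

Lemma out_split_flow : flow D (FinDigraph s' t').
Proof.
apply: (flow_trans dup_out_flow); apply: (flow_trans detour_flow).
apply: flow_sym; apply: (@flow_fold true).
exists None, id, (fun d => if t' d then [:: Some (pe d)]
  else [:: Some (pe d); None]); split=> //=.
- by exists id.
- move=> d d'; have := t'E d; have := t'E d'.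
  case E1 : (t' d) => [u|]; case E2 : (t' d') => [u'|] //= uE u'E [pp].
    by apply: pe_inj => //; rewrite E1 E2 uE u'E pp.
  by apply: pe_inj => //; rewrite E1 E2.
- move=> d; rewrite s'E; have := t'E d; case: (t' d) => [u|] /= uE.
    by rewrite eqxx.
  by rewrite eqxx -uE eqxx.
- by move=> d; have := t'E d; case: (t' d) => [u|] //= ->.
- move=> d; case: (t' d) => [u|]; [left|right]; by exists (Some (pe d)).
- move=> [e|] // _; have [|d pd td] := @pe_surj e (Some (ftgt e)) => //.
  by exists d; rewrite td pd.
- move=> [e|] // [te]; have [|d pd td] := @pe_surj e None => //.
  by exists d; rewrite td pd.
Qed.

End OutSplit.

(** * Graphs of finite-valued maps on a dynamical system *)

(** Isolated vertices can be added one at a time. *)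
Lemma embed_flow (D1 D2 : finDigraph)
    (gv : fV D1 -> fV D2) (ge : fE D1 -> fE D2) :
  injective gv -> bijective ge ->
  (forall d, fsrc (ge d) = gv (fsrc d) /\ ftgt (ge d) = gv (ftgt d)) ->
  flow D1 D2.
Proof.
have [n] := ubnP (#|fV D2| - #|fV D1|)%N.
elim: n D1 gv ge => // n IH D1 gv ge lt gvi geb gst.
have [[v vP]|sur] := pselect (exists v, forall u, gv u <> v); last first.
  apply: (iso_flow _ geb gst); apply: inj_surj_bij => // v.
  by apply: contrapT => nv; apply: sur; exists v => u uv; apply: nv; exists u.
pose D3 := @FinDigraph (option (fV D1)) (fE D1)
  (fun e => Some (fsrc e)) (fun e => Some (ftgt e)).
pose gv3 (u : fV D3) := if u is Some u' then gv u' else v.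
have gv3i : injective gv3.
  by move=> [u|] [u'|] //= => [/gvi ->|/vP|/esym/vP].
apply: (@flow_trans D3).
  apply: flow_add1; exists Some, id; split=> //; first by exists id.
  by exists None => // -[u|]; [right; exists u|left].
apply: (IH D3 gv3 ge) => //.
have := leq_card _ gv3i; rewrite card_option; zlia.
Qed.

Section Mgraph.
Variables (X : Type) (T : int -> X -> X).
Hypothesis T0 : forall x, T 0 x = x.
Hypothesis TD : forall (i j : int) x, T (i + j) x = T i (T j x).

(** The extra label [ep] distinguishes parallel edges, so that a digraph is the
    graph of its source map labelled by its edges. Values that [al] does not
    take are isolated vertices. *)
Definition mgraph (A C : finType) (al : X -> A) (ep : X -> C) : finDigraph :=
  @FinDigraph A {p : A * C * A | `[< exists x, p = (al x, ep x, al (T 1 x)) >]}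
    (fun p => (val p).1.1) (fun p => (val p).2).

(** The Markov property: the past of one point and the future of another can be
    joined as soon as they agree at time 0. *)
Definition glue (A C : finType) (al : X -> A) (ep : X -> C) : Prop :=
  forall x x', al x = al x' -> exists z,
    (forall i : int, i < 0 -> al (T i z) = al (T i x) /\ ep (T i z) = ep (T i x)) /\
    (forall i : int, 0 <= i -> al (T i z) = al (T i x') /\ ep (T i z) = ep (T i x')).

Definition finer (A B : Type) (al : X -> A) (be : X -> B) : Prop :=
  forall x x', al x = al x' -> be x = be x'.

Definition medge (A C : finType) (al : X -> A) (ep : X -> C) (x : X) :
  fE (mgraph al ep) :=
  exist _ (al x, ep x, al (T 1 x)) (asboolT (ex_intro _ x erefl)).

Lemma medgeP (A C : finType) (al : X -> A) (ep : X -> C) (e : fE (mgraph al ep)) :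
  exists x, e = medge al ep x.
Proof.
by case: e => p pP; have /asboolP[x px] := pP; exists x; exact: val_inj.
Qed.

(** Up to isolated vertices the graph depends only on the partitions of X into
    fibres. *)
Lemma mgraph_fibres (A A' C C' : finType) (al : X -> A) (ep : X -> C)
    (al' : X -> A') (ep' : X -> C') :
  finer al al' -> finer al' al ->
  finer (medge al ep) (medge al' ep') -> finer (medge al' ep') (medge al ep) ->
  flow (mgraph al ep) (mgraph al' ep').
Proof.
move=> aa' a'a ee' e'e.
pose V0 := {a : A | `[< exists x, al x = a >]}.
have s0 (e : fE (mgraph al ep)) : `[< exists x, al x = fsrc e >].
  by have [x ->] := medgeP e; apply/asboolP; exists x.
have t0 (e : fE (mgraph al ep)) : `[< exists x, al x = ftgt e >].
  by have [x ->] := medgeP e; apply/asboolP; exists (T 1 x).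
pose D0 := @FinDigraph V0 (fE (mgraph al ep))
  (fun e => exist _ (fsrc e) (s0 e)) (fun e => exist _ (ftgt e) (t0 e)).
apply: (@flow_trans D0).
  apply: flow_sym; apply: (@embed_flow D0 (mgraph al ep) (fun v => val v) id) => //.
  by exists id.
have /choice[vx vxP] (v : V0) : exists x, al x = val v by have /asboolP := svalP v.
have /choice[ex exP] := @medgeP _ _ al ep.
apply: (@embed_flow D0 (mgraph al' ep') (fun v => al' (vx v))
  (fun e => medge al' ep' (ex e))).
- by move=> v v' /a'a; rewrite !vxP => /val_inj.
- apply: inj_surj_bij.
    by move=> e e' /e'e; rewrite -!exP.
  move=> e'; have [x ->] := medgeP e'; exists (medge al ep x).
  by apply: ee'; rewrite -exP.
- move=> e; split; apply: aa'; rewrite vxP /=.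
    by rewrite [in RHS](exP e).
  by rewrite [in RHS](exP e).
Qed.

Lemma medge_eq (A C : finType) (al : X -> A) (ep : X -> C) x x' :
  medge al ep x = medge al ep x' <->
  [/\ al x = al x', ep x = ep x' & al (T 1 x) = al (T 1 x')].
Proof.
split=> [/(congr1 val) /= [-> -> ->] //|[a e t]].
by apply: val_inj; rewrite /= a e t.
Qed.

Lemma mgraph_fibres1 (A A' C : finType) (al : X -> A) (ep : X -> C)
    (al' : X -> A') :
  finer al al' -> finer al' al -> flow (mgraph al ep) (mgraph al' ep).
Proof.
move=> aa' a'a; apply: mgraph_fibres => // x x' /medge_eq[h1 h2 h3];
  by apply/medge_eq; split=> //; auto.
Qed.

Lemma glue_fibres (A A' C : finType) (al : X -> A) (ep : X -> C)
    (al' : X -> A') :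
  finer al al' -> finer al' al -> glue al ep -> glue al' ep.
Proof.
move=> aa' a'a gl x x' /a'a /gl[z [zn zp]]; exists z; split=> i i0.
  by have [za ze] := zn i i0; split=> //; exact: aa'.
by have [za ze] := zp i i0; split=> //; exact: aa'.
Qed.

Section Split.
Variables (A C : finType) (al : X -> A) (ep : X -> C) (a0 : A) (c : X -> bool).
Hypothesis gl : glue al ep.
Hypothesis ca : forall x, c x -> al x = a0.
Hypothesis cE : finer (medge al ep) c.

Definition split_map (x : X) : option A := if c x then None else Some (al x).

Lemma split_finer : finer (medge al ep) split_map.
Proof.
move=> x x' xx'; rewrite /split_map (cE xx').
by have /medge_eq[-> _ _] := xx'.
Qed.

Lemma split_odflt x : odflt a0 (split_map x) = al x.
Proof. by rewrite /split_map; case: ifP => //= /ca ->. Qed.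

Lemma split_glue : glue split_map ep.
Proof.
move=> x x' xx'; have axx : al x = al x' by rewrite -!split_odflt xx'.
have [z [zn zp]] := gl axx; exists z.
have aS (i : int) w : al (T 1 (T i w)) = al (T (i + 1) w) by rewrite -TD addrC.
split=> i i0; [have [za ze] := zn i i0|have [za ze] := zp i i0]; split=> //.
  apply: split_finer; apply/medge_eq; split=> //; rewrite !aS.
  have [i1|i1] := ltP (i + 1) 0; first by have [] := zn _ i1.
  have -> : i + 1 = 0 by zlia.
  by have [] := zp 0 isT; rewrite !T0 => -> _.
apply: split_finer; apply/medge_eq; split=> //; rewrite !aS.
by have [] := zp (i + 1) ltac:(zlia).
Qed.

(** The points with c and those without it over a0 give the two copies of the
    vertex a0. By [glue], an edge into a0 is realised by points that go on to
    either copy, as in an out-splitting. *)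
Lemma split_flow : flow (mgraph al ep) (mgraph split_map ep).
Proof.
(* if one of the two copies is not a value, nothing is split: the out-splitting
   would have a stray edge to the missing copy *)
have [[x1 cx1]|nc] := pselect (exists x, c x); last first.
  have cF x : c x = false by apply/negP => cx; apply: nc; exists x.
  by apply: mgraph_fibres1 => x x'; rewrite /split_map !cF => h; congruence.
have [[x2 [ax2 cx2]]|nc] := pselect (exists x, al x = a0 /\ ~~ c x); last first.
  have cT x : c x = (al x == a0).
    apply/idP/eqP => [/ca //|ax]; apply: contrapT => /negP cx.
    by apply: nc; exists x.
  apply: mgraph_fibres1 => x x'; rewrite /split_map !cT; first by move=> ->.
  by case: eqP => [->|_]; case: eqP => [->|_] // [].
pose c' (e : fE (mgraph al ep)) := `[< exists2 x, e = medge al ep x & c x >].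
have c'E x : c' (medge al ep x) = c x.
  by apply/asboolP/idP => [[x' xx' cx']|cx]; [rewrite (cE xx')|exists x].
have pP (d : fE (mgraph split_map ep)) : `[< exists x,
    (odflt a0 (val d).1.1, (val d).1.2, odflt a0 (val d).2) =
    (al x, ep x, al (T 1 x)) >].
  by have [x ->] := medgeP d; apply/asboolP; exists x; rewrite /= !split_odflt.
pose pe (d : fE (mgraph split_map ep)) : fE (mgraph al ep) :=
  exist _ (odflt a0 (val d).1.1, (val d).1.2, odflt a0 (val d).2) (pP d).
have peE x : pe (medge split_map ep x) = medge al ep x.
  by apply: val_inj; rewrite /= !split_odflt.
apply: (@out_split_flow (mgraph al ep) a0 c' _ _ _ _ pe).
- by move=> e; have [x ->] := medgeP e; rewrite c'E => /ca.
- by move=> d; have [x ->] := medgeP d; rewrite peE c'E.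
- by move=> d; have [x ->] := medgeP d; rewrite peE /= split_odflt.
- move=> d d'; have [x ->] := medgeP d; have [x' ->] := medgeP d'.
  rewrite !peE => ee /= tt; apply/medge_eq; split=> //.
    exact: split_finer.
  by have /medge_eq[] := ee.
- move=> e g; have [x ->] := medgeP e => /= gt.
  have [x' gx'] : exists x', split_map x' = g.
    case: g gt => [a|] /= gt; last by exists x1; rewrite /split_map cx1.
    have [aa|aa] := eqVneq a a0.
      by exists x2; rewrite /split_map (negbTE cx2) ax2 aa.
    exists (T 1 x); rewrite /split_map -gt; case: ifP => // /ca.
    by rewrite -gt => ea; rewrite ea eqxx in aa.
  have ax' : al (T 1 x) = al x' by rewrite -gt -gx' split_odflt.
  have [z [zn zp]] := gl ax'.
  (* time 0 of the joined point z is the end of the edge *)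
  have z1 : T 1 (T (-1) z) = z by rewrite -TD subrr T0.
  have x1E : T (-1) (T 1 x) = x by rewrite -TD addNr T0.
  have [an en] := zn (-1) isT; rewrite x1E in an en.
  have [a_0 e_0] := zp 0 isT; rewrite !T0 in a_0 e_0.
  have [a_1 e_1] := zp 1 isT.
  exists (medge split_map ep (T (-1) z)).
    by rewrite peE; apply/medge_eq; rewrite z1; split=> //; rewrite a_0.
  rewrite /= z1 -gx'; apply: split_finer; exact/medge_eq.
Qed.

End Split.

(** If be refines al and is determined by the al-edge, be is obtained from al by
    splitting off its values one at a time. *)
Lemma refine_flow (A B C : finType) (al : X -> A) (be : X -> B) (ep : X -> C) :
  glue al ep -> finer be al -> finer (medge al ep) be ->
  flow (mgraph al ep) (mgraph be ep).
Proof.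
move=> gl ba ab.
pose ga (l : seq B) (x : X) := (al x, if be x \in l then Some (be x) else None).
have bga l : finer be (ga l) by move=> x x' xx'; rewrite /ga xx' (ba _ _ xx').
have H l : flow (mgraph al ep) (mgraph (ga l) ep) /\ glue (ga l) ep.
  elim: l => [|b l [IHf IHg]].
    have f1 : finer al (ga [::]) by move=> x x' xx'; rewrite /ga !in_nil xx'.
    have f2 : finer (ga [::]) al by move=> x x' [].
    by split; [exact: mgraph_fibres1|exact: glue_fibres gl].
  have [bl|bl] := boolP (b \in l).
    suff -> : ga (b :: l) = ga l by [].
    apply/funext => x; rewrite /ga in_cons.
    by case: eqP => [->|//]; rewrite bl.
  have [[xb xbE]|nb] := pselect (exists x, be x = b); last first.
    suff -> : ga (b :: l) = ga l by [].
    apply/funext => x; rewrite /ga in_cons; case: eqP => // bx.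
    by case: nb; exists x.
  pose c x := be x == b.
  have ca x : c x -> ga l x = ga l xb.
    by move=> /eqP bx; apply: bga; rewrite bx.
  have cE : finer (medge (ga l) ep) c.
    move=> x x' /medge_eq[[e1 _] e2 [e3 _]]; rewrite /c (ab x x') //.
    exact/medge_eq.
  have f1 : finer (split_map (ga l) c) (ga (b :: l)).
    move=> x x'; rewrite /split_map /c /ga !in_cons.
    case: eqP => [bx|bx]; case: eqP => [bx'|bx'] //=; last by case=> -> ->.
    by move=> _; rewrite bx bx' (ba x x') // bx.
  have f2 : finer (ga (b :: l)) (split_map (ga l) c).
    move=> x x'; rewrite /split_map /c /ga !in_cons.
    case: eqP => [bx|bx]; case: eqP => [bx'|bx'] //=.
    + by case: ifP => // _ [_ bb]; case: bx'; rewrite -bb.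
    + by case: ifP => // _ [_ bb]; case: bx; rewrite bb.
    + by case=> -> ->.
  split.
    apply: flow_trans IHf _; apply: flow_trans (split_flow IHg ca cE) _.
    exact: mgraph_fibres1.
  exact: glue_fibres f1 f2 (split_glue IHg ca cE).
have [Hf _] := H (enum B); apply: flow_trans Hf _; apply: mgraph_fibres1 => //.
by move=> x x'; rewrite /ga !mem_enum => -[].
Qed.

End Mgraph.

(** Time reversal turns the refinement by the next value into the refinement by
    the previous one. *)
Lemma refine_flow_past (X : Type) (T : int -> X -> X)
    (T0 : forall x, T 0 x = x) (TD : forall (i j : int) x, T (i + j) x = T i (T j x))
    (A B : finType) (al : X -> A) (be : X -> B) :
  glue T al (fun=> tt) -> finer be al ->
  (forall x x', al x = al x' -> al (T (-1) x) = al (T (-1) x') -> be x = be x') ->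
  flow (mgraph T al (fun=> tt)) (mgraph T be (fun=> tt)).
Proof.
move=> gl ba ab; pose T' i := T (- i).
have rev_flow (A' : finType) (al' : X -> A') :
    flow (op (mgraph T al' (fun=> tt))) (mgraph T' al' (fun=> tt)).
  have gP (d : fE (op (mgraph T al' (fun=> tt)))) :
      `[< exists x, ((val d).2, (val d).1.2, (val d).1.1) =
                    (al' x, tt, al' (T' 1 x)) >].
    have [x ->] := medgeP d; apply/asboolP; exists (T 1 x).
    by rewrite /= /T' -TD addNr T0.
  apply: (@iso_flow (op (mgraph T al' (fun=> tt))) (mgraph T' al' (fun=> tt)) id
    (fun d => exist _ ((val d).2, (val d).1.2, (val d).1.1) (gP d))) => //.
    by exists id.
  apply: inj_surj_bij.
    move=> [[[a []] b] p] [[[a' []] b'] p'] /= [bb aa].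
    by apply: val_inj; rewrite /= aa bb.
  move=> d; have [x ->] := medgeP d; exists (medge T al' (fun=> tt) (T' 1 x)).
  by apply: val_inj; rewrite /= /T' -TD subrr T0.
have gl' : glue T' al (fun=> tt).
  move=> x x' xx'; have [z [zn zp]] := gl _ _ (esym xx').
  exists z; split=> i i0; split=> //.
    by have [] := zp (- i) ltac:(zlia).
  have [->|ii] := eqVneq i 0; last by have [] := zn (- i) ltac:(zlia).
  by have [] := zp 0 isT; rewrite /T' oppr0 !T0 xx' => ->.
have rf : flow (mgraph T' al (fun=> tt)) (mgraph T' be (fun=> tt)).
  apply: refine_flow => //.
  - by move=> i j x; rewrite /T' opprD TD.
  - by move=> x x' /medge_eq[e1 _ e2]; apply: ab.
have := flow_trans (rev_flow A al) (flow_trans rf (flow_sym (rev_flow B be))).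
by move=> /flow_op.
Qed.

(** * Conjugate shift spaces have flow-related digraphs *)

Lemma shiftn0 (D : finDigraph) (x : biwalk D) : shiftn 0 x = x.
Proof. by apply: biwalk_ext => i; rewrite ed_shiftn addr0. Qed.

Lemma shiftnD (D : finDigraph) (i j : int) (x : biwalk D) :
  shiftn (i + j) x = shiftn i (shiftn j x).
Proof. by apply: biwalk_ext => m; rewrite !ed_shiftn addrA. Qed.

Definition agree (D : finDigraph) (a b : int) (x x' : biwalk D) : Prop :=
  forall i, a <= i < b -> ed x i = ed x' i.

Definition win (D : finDigraph) (a b : int) (x : biwalk D) :
  {ffun 'I_(absz (b - a)%R) -> fE D} :=
  [ffun j : 'I__ => ed x (a + (j : nat)%:Z)].

Lemma winP (D : finDigraph) (a b : int) (x x' : biwalk D) : a <= b ->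
  win a b x = win a b x' <-> agree a b x x'.
Proof.
move=> ab; split=> [/ffunP xx i iab|xx]; last first.
  by apply/ffunP => j; rewrite !ffunE; apply: xx; have := ltn_ord j; zlia.
have ij : (absz (i - a)%R < absz (b - a)%R)%N by zlia.
have := xx (Ordinal ij); rewrite !ffunE /=.
by have -> : a + (absz (i - a)%R)%:Z = i by zlia.
Qed.

Lemma agree_shiftn (D : finDigraph) (a b k : int) (x x' : biwalk D) :
  agree a b (shiftn k x) (shiftn k x') <-> agree (a + k) (b + k) x x'.
Proof.
split=> xx i iab; last by rewrite !ed_shiftn; apply: xx; zlia.
have := xx (i - k); rewrite !ed_shiftn subrK; apply; zlia.
Qed.

Lemma join_walks (D : finDigraph) (m : int) (x x' : biwalk D) :
  fsrc (ed x m) = fsrc (ed x' m) ->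
  exists z : biwalk D, (forall i, i < m -> ed z i = ed x i) /\
                       (forall i, m <= i -> ed z i = ed x' i).
Proof.
move=> xx; have [|z zE] := @biwalk_of D (fun i => if i < m then ed x i else ed x' i).
  move=> i; case: ltP => im; case: ltP => im1; rewrite ?ed_path //.
    have -> : i + 1 = m by zlia.
    by [].
  zlia.
exists z; split=> i im; rewrite zE; first by rewrite im.
by rewrite ltNge im.
Qed.

Definition essential (D : finDigraph) (e : fE D) : bool :=
  `[< exists (x : biwalk D) (i : int), ed x i = e >].

(** If no edge of R leaves a source or enters a sink, each edge of R continues
    within R in both directions and so lies on a bi-infinite walk. *)
Lemma trim_flow (D : finDigraph) : flow (dsub (@essential D)) D.
Proof.
apply: (@flow_trans (dsub (fun _ => true)) _ _ _ (dsubT _)).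
apply: dsub_chain => // R PR [e0 /andP[Re0 /negP ne0]].
apply: contrapT => nx; apply: ne0.
have ess (e : fE D) : R e ->
    (exists2 f, R f & ftgt e = fsrc f) /\ (exists2 f, R f & ftgt f = fsrc e).
  move=> Re; have [/asboolP[x [i xi]]|ne] := boolP (essential e).
    have essx j : essential (ed x j) by apply/asboolP; exists x, j.
    split; [exists (ed x (i + 1))|exists (ed x (i - 1))]; rewrite ?PR //.
      by rewrite -xi ed_path.
    by rewrite ed_path subrK xi.
  split; apply: contrapT => nf; apply: nx; exists e; split; rewrite ?Re //.
    by right=> f Rf fe0; apply: nf; exists f.
  by left=> f Rf fe0; apply: nf; exists f.
have [||f [f0 _ fS]] := @int_path (fE D) R (fun e f => ftgt e = fsrc f) e0 Re0.
- by move=> e /ess[].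
- by move=> e /ess[].
have [x xE] := @biwalk_of D f fS.
by apply/asboolP; exists x, 0; rewrite xE f0.
Qed.

Section OneSpace.
Variable D : finDigraph.
Notation X := (biwalk D).
Notation T := (fun i => @shiftn D i : X -> X).

(** The essential part of D is the graph of the source map labelled by the edges;
    the edge at position a refines the source and is determined by the label. *)
Lemma edge_graph_flow (a : int) :
  flow D (mgraph T (win a (a + 1)) (fun=> tt)).
Proof.
apply: flow_trans (flow_sym (trim_flow D)) _.
pose al (x : X) := fsrc (ed x a); pose ep (x : X) := ed x a.
have ae : a <= a + 1 by zlia.
have eP (d : fE (mgraph T al ep)) : essential (val d).1.2.
  by have [x ->] := medgeP d; apply/asboolP; exists x, a.
apply: (@flow_trans (mgraph T al ep)).
  apply: flow_sym; apply: (@iso_flow (mgraph T al ep) (dsub (@essential D)) id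
    (fun d => exist _ (val d).1.2 (eP d))).
  - by exists id.
  - apply: inj_surj_bij => [d d'|[e ee]].
      have [x ->] := medgeP d; have [x' ->] := medgeP d' => -[xx].
      apply/medge_eq; split=> //; first by congr fsrc.
      by rewrite /al /= !ed_shiftn -!ed_path; congr ftgt.
    have /asboolP[x [i xi]] := ee.
    exists (medge T al ep (shiftn (i - a) x)); apply: val_inj.
    by rewrite /= /ep ed_shiftn -xi; congr (ed x _); zlia.
  - move=> d; have [x ->] := medgeP d; split=> //=.
    by rewrite ed_path.
have gl : glue T al ep.
  move=> x x' /join_walks[z [zn zp]]; exists z; split=> i i0.
    by rewrite /al /ep /= !ed_shiftn zn //; zlia.
  by rewrite /al /ep /= !ed_shiftn zp //; zlia.
have epw x x' : ep x = ep x' <-> agree a (a + 1) x x'.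
  split=> [xx i ia|xx]; last by apply: xx; zlia.
  by have -> : i = a by zlia.
apply: (@flow_trans (mgraph T (win a (a + 1)) ep)).
  apply: refine_flow => //.
  - exact: shiftn0.
  - exact: shiftnD.
  - by move=> x x' /(winP _ _ ae) /epw; rewrite /al => xx; congr fsrc.
  - by move=> x x' /medge_eq[_ /epw/(winP _ _ ae)].
apply: mgraph_fibres => // x x' /medge_eq[h1 h2 h3]; apply/medge_eq; split=> //.
exact/epw/(winP _ _ ae).
Qed.

Lemma win_glue (a b : int) : a < b -> glue T (win a b) (fun=> tt).
Proof.
move=> ab x x' /(winP _ _ (ltW ab)) xx.
have [|z [zn zp]] := @join_walks D a x x'.
  by congr fsrc; apply: xx; zlia.
exists z; split=> i i0; split=> //; apply/(winP _ _ (ltW ab))/agree_shiftn => j ja.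
  have [jl|jl] := ltP j a; first exact: zn.
  by rewrite zp // xx //; zlia.
by rewrite zp //; zlia.
Qed.

Lemma win_flow (a : int) (n : nat) :
  flow D (mgraph T (win a (a + n.+1%:Z)) (fun=> tt)).
Proof.
elim: n => [|n IH]; first exact: edge_graph_flow.
apply: flow_trans IH _.
have an : a < a + n.+1%:Z by zlia.
have an' : a <= a + n.+2%:Z by zlia.
apply: refine_flow.
- exact: shiftn0.
- exact: shiftnD.
- exact: win_glue.
- move=> x x' /(winP _ _ an') xx; apply/(winP _ _ (ltW an)) => i ia.
  by apply: xx; zlia.
- move=> x x' /medge_eq[/(winP _ _ (ltW an)) xx _].
  move=> /(winP _ _ (ltW an))/agree_shiftn xx1; apply/(winP _ _ an') => i ia.
  have [lt|ge] := ltP i (a + n.+1%:Z); first by apply: xx; zlia.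
  by apply: xx1; zlia.
Qed.

End OneSpace.

(** Sliding block codes of radius N. *)
Definition coded (D1 D2 : finDigraph) (N : nat) (h : biwalk D1 -> biwalk D2) :=
  forall x x' i, agree (i - N%:Z) (i + N.+1%:Z) x x' -> ed (h x) i = ed (h x') i.

Section TwoSpaces.
Variables (D1 D2 : finDigraph).
Variables (h : biwalk D1 -> biwalk D2) (k : biwalk D2 -> biwalk D1) (N : nat).
Hypotheses (hK : cancel h k) (kK : cancel k h).
Hypothesis hT : forall i x, h (shiftn i x) = shiftn i (h x).
Hypotheses (hN : coded N h) (kN : coded N k).
Notation X := (biwalk D1).
Notation T := (fun i => @shiftn D1 i : X -> X).
Notation M := (N%:Z).
Notation L := (N.*2.+1%:Z).

(** The window of x is long enough that it determines h x at position N. *)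
Definition jwin (c d : int) (x : X) := (win 0 L x, win c d (h x)).

Lemma jwinP (c d : int) (x x' : X) : c <= d ->
  jwin c d x = jwin c d x' <-> agree 0 L x x' /\ agree c d (h x) (h x').
Proof.
move=> cd; have L0 : 0 <= L by zlia.
split=> [[/(winP _ _ L0) ? /(winP _ _ cd) ?] //|[xx yy]].
by congr pair; [apply/(winP _ _ L0)|apply/(winP _ _ cd)].
Qed.

Lemma jwinP_shift (c d i : int) (x x' : X) : c <= d ->
  jwin c d (shiftn i x) = jwin c d (shiftn i x') <->
  agree i (L + i) x x' /\ agree (c + i) (d + i) (h x) (h x').
Proof.
move=> cd; rewrite (jwinP _ _ cd) !hT !agree_shiftn add0r.
by [].
Qed.

(** The window of x determines h x at N; so the image of the joined point follows
    h x up to N and h x' from N on. *)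
Lemma jwin_glue (c d : int) : c <= M -> M < d -> glue T (jwin c d) (fun=> tt).
Proof.
move=> cM Md; have cd : c <= d by zlia.
move=> x x' /(jwinP _ _ cd)[xx yy].
have [|z [zn zp]] := @join_walks D1 0 x x'.
  by congr fsrc; apply: xx; zlia.
have zx i : i < L -> ed z i = ed x i.
  move=> iL; have [lt|ge] := ltP i 0; first exact: zn.
  by rewrite zp // xx //; zlia.
have wx i : i <= M -> ed (h z) i = ed (h x) i.
  by move=> iM; apply: hN => j ja; apply: zx; zlia.
have wx' i : M <= i -> ed (h z) i = ed (h x') i.
  by move=> iM; apply: hN => j ja; apply: zp; zlia.
have xzn i : i < d -> ed (h z) i = ed (h x) i.
  move=> id0; have [le|lt] := leP i M; first exact: wx.
  by rewrite wx' ?yy //; zlia.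
have xzp i : c <= i -> ed (h z) i = ed (h x') i.
  move=> ci; have [le|lt] := leP M i; first exact: wx'.
  by rewrite wx ?yy //; zlia.
exists z; split=> i i0; split=> //; apply/jwinP_shift => //; split=> j ja.
- by apply: zx; zlia.
- by apply: xzn; zlia.
- by apply: zp; zlia.
- by apply: xzp; zlia.
Qed.

Lemma jwin_right (r : nat) :
  flow (mgraph T (jwin M (M + 1)) (fun=> tt))
       (mgraph T (jwin M (M + r.+1%:Z)) (fun=> tt)).
Proof.
elim: r => [|r IH]; first exact: flow_refl.
apply: flow_trans IH _.
have c1 : M <= M + r.+1%:Z by zlia.
have c2 : M <= M + r.+2%:Z by zlia.
apply: refine_flow.
- exact: shiftn0.
- exact: shiftnD.
- by apply: jwin_glue; zlia.
- move=> x x' /(jwinP _ _ c2)[xx yy]; apply/jwinP => //; split=> // i ia.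
  by apply: yy; zlia.
- move=> x x' /medge_eq[/(jwinP _ _ c1)[xx yy] _ /(jwinP_shift _ _ _ c1)[_ yy1]].
  apply/jwinP => //; split=> // i ia.
  have [lt|ge] := ltP i (M + r.+1%:Z); first by apply: yy; zlia.
  by apply: yy1; zlia.
Qed.

Lemma jwin_left (d : int) (l : nat) : M < d ->
  flow (mgraph T (jwin M d) (fun=> tt)) (mgraph T (jwin (M - l%:Z) d) (fun=> tt)).
Proof.
move=> Md; elim: l => [|l IH]; first by rewrite [M - _]subr0; exact: flow_refl.
apply: flow_trans IH _.
have c1 : M - l%:Z <= d by zlia.
have c2 : M - l.+1%:Z <= d by zlia.
apply: refine_flow_past.
- exact: shiftn0.
- exact: shiftnD.
- by apply: jwin_glue; zlia.
- move=> x x' /(jwinP _ _ c2)[xx yy]; apply/jwinP => //; split=> // i ia.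
  by apply: yy; zlia.
- move=> x x' /(jwinP _ _ c1)[xx yy] /(jwinP_shift _ _ _ c1)[_ yy1].
  apply/jwinP => //; split=> // i ia.
  have [lt|ge] := ltP i (M - l%:Z); first by apply: yy1; zlia.
  by apply: yy; zlia.
Qed.

Lemma mgraph_transport (A : finType) (al : biwalk D2 -> A) :
  flow (mgraph T (fun x => al (h x)) (fun=> tt))
       (mgraph (fun i => @shiftn D2 i : biwalk D2 -> biwalk D2) al (fun=> tt)).
Proof.
pose tg (P : pred (A * unit * A)) := @FinDigraph A {p | P p}
  (fun p => (val p).1.1) (fun p => (val p).2).
rewrite /mgraph -/(tg _) -/(tg _).
set P1 := fun p => _; set P2 := fun p => _.
suff -> : P1 = P2 by exact: flow_refl.
apply/funext => p; apply/asboolP/asboolP => [[x ->]|[y ->]].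
  by exists (h x); rewrite hT.
by exists (k y); rewrite hT kK.
Qed.

(** The window of h x grows from position N to the positions from -N to 3N, where
    it determines the window of x through the inverse code. *)
Lemma conj_flow : flow D1 D2.
Proof.
have L0 : 0 <= L by zlia.
apply: flow_trans (win_flow D1 0 N.*2) _; rewrite add0r.
have M1 : M <= M + 1 by zlia.
have w1 : finer (win 0 L) (jwin M (M + 1)).
  move=> x x' /(winP _ _ L0) xx; apply/jwinP => //; split=> // i ia.
  by apply: hN => j ja; apply: xx; zlia.
have w2 : finer (jwin M (M + 1)) (win 0 L) by move=> x x' [].
apply: flow_trans (mgraph_fibres1 _ _ w1 w2) _; apply: flow_trans (jwin_right N.*2) _.
have Md : M < M + L by zlia.
apply: flow_trans (jwin_left N.*2 Md) _.
have cd : M - N.*2%:Z <= M + L by zlia.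
have w3 : finer (jwin (M - N.*2%:Z) (M + L))
    (fun x => win (M - N.*2%:Z) (M + L) (h x)) by move=> x x' [].
have w4 : finer (fun x => win (M - N.*2%:Z) (M + L) (h x))
    (jwin (M - N.*2%:Z) (M + L)).
  move=> x x' /(winP _ _ cd) yy; apply/jwinP => //; split=> // i ia.
  by rewrite -(hK x) -(hK x'); apply: kN => j ja; apply: yy; zlia.
apply: flow_trans (mgraph_fibres1 _ _ w3 w4) _.
apply: flow_trans (mgraph_transport _) _.
apply: flow_sym; have := win_flow D2 (M - N.*2%:Z) (N.*2 + N.*2)%N.
have -> // : M - N.*2%:Z + (N.*2 + N.*2).+1%:Z = M + L by zlia.
Qed.

End TwoSpaces.

(** * Conjugacies are sliding block codes *)

Lemma ptws_cvg (K : choiceType) (f : int -> K)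
    (F : set_system {ptws int -> discrete_topology K}) :
  Filter F -> (forall i, F [set g | g i = f i]) ->
  F --> (f : {ptws int -> discrete_topology K}).
Proof.
move=> FF Fi; apply/cvg_sup => i A /=.
move=> [_ [[B Bop <-] Bfi sBA]].
by apply: filterS (Fi i) => g /= gi; apply: sBA; rewrite /= gi.
Qed.

(** The sets of points that agree with x on a window form a filter that converges
    to x coordinate by coordinate. *)
Lemma nbhs_window (D : finDigraph) (x : shift_space D)
    (A : set (shift_space D)) :
  nbhs x A -> exists M : nat, forall x' : biwalk D,
    agree (- M%:Z) M%:Z (x : biwalk D) x' -> A x'.
Proof.
pose W : set_system (biwalk D) :=
  filter_from [set: nat]
    (fun M => [set x' | agree (- M%:Z) M%:Z (x : biwalk D) x']).
have WF : Filter W.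
  apply: filter_from_filter; first by exists 0%N.
  move=> M N _ _; exists (maxn M N) => // x' /= xx.
  by split=> i ia; apply: xx; zlia.
have near_ed i : W [set x' | ed x' i = ed x i].
  exists (absz i).+1 => // x' /= xx; apply/esym/xx; zlia.
move=> [_ [[B Bop <-] Bx sBA]].
suff : W (@coords D @^-1` B) by move=> [M _ sM]; exists M => x' /sM /sBA.
have : nbhs (coords x) B by exact: open_nbhs_nbhs.
move=> [[Q1 Q2] [/= nQ1 nQ2] sQ].
have W1 : W ((fun x' => (coords x').1) @^-1` Q1).
  apply: (@ptws_cvg _ _ ((fun x' : biwalk D => (coords x').1) @ W)) nQ1 => i.
  by apply: filterS (near_ed i) => x' /= xi; rewrite -!line_src [hE _ _]xi.
have W2 : W ((fun x' => (coords x').2) @^-1` Q2).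
  apply: (@ptws_cvg _ _ ((fun x' : biwalk D => (coords x').2) @ W)) nQ2 => i.
  exact: near_ed.
by apply: filterS (filterI W1 W2) => x' [q1 q2]; apply: sQ.
Qed.

Lemma continuous_window (D1 D2 : finDigraph)
    (f : shift_space D1 -> shift_space D2) (x : shift_space D1) :
  continuous f -> exists M : nat, forall x' : biwalk D1,
    agree (- M%:Z) M%:Z (x : biwalk D1) x' ->
    ed (f x' : biwalk D2) 0 = ed (f x : biwalk D2) 0.
Proof.
move=> fc; pose U : set (shift_space D2) :=
  [set y | ed (y : biwalk D2) 0 = ed (f x : biwalk D2) 0].
have oU : open U.
  pose P1 := {ptws int -> discrete_topology (fV D2)}.
  pose P2 := {ptws int -> discrete_topology (fE D2)}.
  pose g : P1 * P2 -> discrete_topology (fE D2) := fun p => p.2 0.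
  have gc : continuous g.
    move=> p; apply: (@continuous_comp _ _ _ (@snd P1 P2)
      (@proj int (fun=> discrete_topology (fE D2)) 0)).
      exact: cvg_snd.
    exact: proj_continuous.
  exists (g @^-1` [set ed (f x : biwalk D2) 0]) => //.
  by move/continuousP: gc; apply; exact: discrete_open.
apply: nbhs_window (f @^-1` U) _; apply: fc; exact: open_nbhs_nbhs.
Qed.

(** A local dependence on finitely many coordinates is uniform: otherwise, by
    finiteness of the alphabet, windows that allow arbitrarily long
    counterexamples can be extended step by step, and the dependence fails at
    their limit. *)
Lemma uniform_window (D1 D2 : finDigraph) (f : biwalk D1 -> biwalk D2) :
  (forall x, exists M : nat, forall x', agree (- M%:Z) M%:Z x x' ->
     ed (f x') 0 = ed (f x) 0) ->
  exists N : nat, forall x x', agree (- N%:Z) N%:Z x x' ->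
     ed (f x) 0 = ed (f x') 0.
Proof.
move=> loc; apply: contrapT => nN.
(* here p stands for its window of radius n around 0 *)
pose bad (n : nat) (p : biwalk D1) := forall M : nat, exists x x',
  [/\ agree (- n%:Z) n%:Z p x, agree (- M%:Z) M%:Z x x' &
      ed (f x) 0 <> ed (f x') 0].
have ext_bad (n : nat) (p : biwalk D1) :
    bad n p -> exists p', bad n.+1 p' /\ agree (- n%:Z) n%:Z p p'.
  move=> bp; apply: contrapT => np.
  have nn : - n.+1%:Z <= n.+1%:Z by zlia.
  have /choice[m mP] (w : {ffun 'I_(absz (n.+1%:Z - - n.+1%:Z)%R) -> fE D1}) :
      exists M : nat, forall p', win (- n.+1%:Z) n.+1%:Z p' = w ->
        agree (- n%:Z) n%:Z p p' ->
        forall x x', agree (- n.+1%:Z) n.+1%:Z p' x ->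
          agree (- M%:Z) M%:Z x x' -> ed (f x) 0 = ed (f x') 0.
    apply: contrapT => nM.
    have [[p' [wp ap]]|np'] := pselect (exists p',
        win (- n.+1%:Z) n.+1%:Z p' = w /\ agree (- n%:Z) n%:Z p p'); last first.
      by apply: nM; exists 0%N => p' wp ap; case: np'; exists p'.
    apply: np; exists p'; split=> // M.
    apply: contrapT => nx; apply: nM; exists M => p2 w2 a2 x x' px xx.
    apply: contrapT => fx; apply: nx; exists x, x'; split=> //.
    have /(winP _ _ nn) pp2 :
        win (- n.+1%:Z) n.+1%:Z p' = win (- n.+1%:Z) n.+1%:Z p2.
      by rewrite wp w2.
    by move=> i ia; rewrite pp2 // px.
  have [x [x' [px xx fx]]] := bp (\max_w m w)%N.
  apply: fx; apply: (mP (win (- n.+1%:Z) n.+1%:Z x) x erefl px) => // i ia.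
  apply: xx; have := @leq_bigmax _ m (win (- n.+1%:Z) n.+1%:Z x); zlia.
have [p0 bp0] : exists p0, bad 0%N p0.
  have [x0 _] : exists x0 : biwalk D1, True.
    by apply: contrapT => nx; apply: nN; exists 0%N => x; case: nx; exists x.
  exists x0 => M; apply: contrapT => nx; apply: nN; exists M => x x' xx.
  by apply: contrapT => fx; apply: nx; exists x, x'; split=> // i; zlia.
have /choice[nx nxP] (t : nat * biwalk D1) : exists p', bad t.1 t.2 ->
    bad t.1.+1 p' /\ agree (- t.1%:Z) t.1%:Z t.2 p'.
  have [/ext_bad[p' pP]|nb] := pselect (bad t.1 t.2); first by exists p'.
  by exists p0.
pose p := fix p n := if n is m.+1 then nx (m, p m) else p0.
have pbad n : bad n (p n) by elim: n => // n /(nxP (n, p n))[].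
have pS n : agree (- n%:Z) n%:Z (p n) (p n.+1).
  by have [] := nxP (n, p n) (pbad n).
have pD n m : agree (- n%:Z) n%:Z (p n) (p (n + m)%N).
  elim: m => [|m IH] i ia; first by rewrite addn0.
  by rewrite IH // addnS; apply: pS; zlia.
have pE (i : int) n : - n%:Z <= i < n%:Z -> ed (p (absz i).+1) i = ed (p n) i.
  move=> ia; have [le|lt] := leqP n (absz i).+1.
    by rewrite -(subnKC le) -(pD n).
  by rewrite -(subnKC (ltnW lt)) -(pD (absz i).+1) //; zlia.
have [|x xE] := @biwalk_of D1 (fun i => ed (p (absz i).+1) i).
  by move=> i; rewrite !(pE _ (absz i).+2) ?ed_path //; zlia.
have [M xM] := loc x; have [y [y' [py yy fy]]] := pbad M M.
have xy : agree (- M%:Z) M%:Z x y by move=> i ia; rewrite xE (pE _ M) // py.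
apply: fy; rewrite (xM y xy) (xM y') // => i ia.
by rewrite xy // yy.
Qed.

Lemma conj_shiftn (D1 D2 : finDigraph) (h : biwalk D1 -> biwalk D2) :
  (forall x, h (shift x) = shift (h x)) ->
  forall (i : int) x, h (shiftn i x) = shiftn i (h x).
Proof.
have s1 (D : finDigraph) (x : biwalk D) : shiftn 1 x = shift x.
  by apply: biwalk_ext => i.
move=> hS; apply: int_succ_ind => [x|z]; first by rewrite !shiftn0.
have hp x : h (shiftn (-1) x) = shiftn (-1) (h x).
  have {2}-> : x = shift (shiftn (-1) x) by rewrite -s1 -shiftnD subrr shiftn0.
  by rewrite hS -s1 -shiftnD addNr shiftn0.
split=> H x; first by rewrite !shiftnD !s1 H hS.
have zE : z = z + 1 + -1 by zlia.
by rewrite zE !(shiftnD (z + 1)) H hp.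
Qed.

Lemma coded_of_continuous (D1 D2 : finDigraph)
    (h : shift_space D1 -> shift_space D2) :
  continuous h ->
  (forall (i : int) (x : biwalk D1),
     (h (shiftn i x) : biwalk D2) = shiftn i (h x : biwalk D2)) ->
  exists N0 : nat, forall N, (N0 <= N)%N ->
    coded N (h : biwalk D1 -> biwalk D2).
Proof.
move=> hc hS; have [|N0 NP] := @uniform_window D1 D2 h.
  by move=> x; exact: continuous_window.
exists N0 => N N0N x x' i xx.
have := NP (shiftn i x) (shiftn i x'); rewrite !hS !ed_shiftn add0r; apply.
by apply/agree_shiftn => j ja; apply: xx; zlia.
Qed.

Lemma conjugate_flow (D1 D2 : finDigraph) :
  strong_shift_equivalent D1 D2 -> flow D1 D2.
Proof.
move=> [h [k [hc kc hK kK hS]]].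
have kS x : k (shift x) = shift (k x) by rewrite -[x in LHS]kK -hS hK.
have hT := conj_shiftn hS; have kT := conj_shiftn kS.
have [N1 hN] := coded_of_continuous hc hT.
have [N2 kN] := coded_of_continuous kc kT.
apply: (@conj_flow D1 D2 h k (maxn N1 N2) hK kK hT).
  exact/hN/leq_maxl.
exact/kN/leq_maxr.
Qed.

Theorem corollary3p5 (D1 D2 : udafDigraph) :
  strong_shift_equivalent D1 D2 -> isomorphic_in UDAFG' D1 D2.
Proof.
case: D1 D2 => [D1 U1] [D2 U2] /= sse.
exact: flow_iso (conjugate_flow sse) U1 U2.
Qed.
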